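(* Let $K=\mathbf{k}[Y|R]=\mathbf{k}[Y]/Id(R)$ be an arbitrary commutative $\mathbf{k}$-algebra, $R\subseteq\mathbf{k}[Y]$. Let $S$ be a Gröbner–Shirshov basis in $Lie_{\mathbf{k}[Y]}(X)$ such that every $s\in S$ is $\mathbf{k}[Y]$-monic. Then the Lie $K$-algebra $\mathcal{L}=Lie_K(X|S)$ is embeddable into its universal enveloping algebra $U_K(\mathcal{L})=K\langle X|S^{(-)}\rangle$, i.e., the canonical $K$-linear map $\mathcal{L}\to U_K(\mathcal{L})$ induced by $x\mapsto x$ is injective.
   Context: Let $\mathbf{k}$ be a field and $X$, $Y$ well-ordered sets. $X^*$ is the free monoid on $X$. Lex ordering $>$ on $X^*$: $1>t$ for every $t\neq1$, and for $u=xu'$, $v=x'v'$ ($x,x'\in X$), $u>v$ iff $x>x'$, or $x=x'$ and $u'>v'$. Deg-lex $\succ_X$: longer words are bigger, equal lengths compared by lex. $w\ne1$ is an ALSW if $w>vu$ for all factorizations $w=uv$, $u,v\neq1$; $ALSW(X)$ is their set. Every $c\in X^*$ factors uniquely as $c=c_1\cdots c_n$, $c_i\in ALSW(X)$, $c_1\le\cdots\le c_n$. Each $w\in ALSW(X)$ has a standard bracketing $[w]$: $[w]=w$ if $|w|=1$, else $[w]=[[u],[v]]$ with $v$ the longest proper ALSW suffix of $w$. $[Y]$ is the free commutative monoid on $Y$ with deg-lex order $\succ_Y$; $\mathbf{k}[Y]\langle X\rangle$ is the free associative $\mathbf{k}[Y]$-algebra on $X$ with $\mathbf{k}$-basis $[Y]X^*=\{u^Yu^X\}$;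 $Lie_{\mathbf{k}[Y]}(X)$ is its $\mathbf{k}[Y]$-Lie subalgebra generated by $X$ under $[p,q]=pq-qp$. Order $[Y]X^*$ by $u\succ v$ iff $u^X\succ_Xv^X$, or $u^X=v^X$ and $u^Y\succ_Y v^Y$. For nonzero $f$, $\bar f=\bar f^Y\bar f^X$ is the $\succ$-largest element of $[Y]X^*$ occurring in $f$; $f$ is $\mathbf{k}$-monic if its coefficient is $1$. Writing $f\in Lie_{\mathbf{k}[Y]}(X)$ uniquely as $f=\sum_i f_i(Y)[u_i]$ with $0\ne f_i\in\mathbf{k}[Y]$, distinct $u_i\in ALSW(X)$, $u_1\succ_Xu_2\succ_X\cdots$, $f$ is $\mathbf{k}[Y]$-monic if $f_1=1$. Special bracketing: if $u\in ALSW(X)$, $a,b\in X^*$, $aub\in ALSW(X)$, then $[aub]=[a[uc]d]$ with $b=cd$ and $[uc]$ the standard bracketing of $uc$ occurring as a sub-bracket; with $c=c_1\cdots c_n$ the nondecreasing ALSW factorization, $[aub]_u$ is obtained by replacing $[uc]$ with $[\cdots[[u,[c_1]],[c_2]],\dots,[c_n]]$. For $\mathbf{k}$-monic $s$ and $a,b$ with $a\bar s^Xb\in ALSW(X)$, the normal $s$-word $[asb]_{\bar s}$ is obtained from $[a\bar s^Xb]_{\bar s^X}$ by replacing the sub-bracket $[\bar s^X]$ by $s$. Compositions of $\mathbf{k}$-monic $f,g$, with $L=\mathrm{lcm}(\bar f^Y,\bar g^Y)$: (1) if $\bar f^X=a\bar g^Xb$, $C_1\langle f,g\rangle_w=\frac{L}{\bar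 f^Y}f-\frac{L}{\bar g^Y}[agb]_{\bar g}$, $w=L\bar f^X$; (2) if $\bar f^X=aa_0$, $\bar g^X=a_0b$, $a,b,a_0\neq1$, $C_2\langle f,g\rangle_w=\frac{L}{\bar f^Y}[fb]_{\bar f}-\frac{L}{\bar g^Y}[ag]_{\bar g}$, $w=L\bar f^Xb$; (3) if $\gcd(\bar f^Y,\bar g^Y)\neq1$, for any $a,b,c$ with $a\bar f^Xb\bar g^Xc\in ALSW(X)$, $C_3\langle f,g\rangle_w=\frac{L}{\bar f^Y}[af(b\bar g^Xc)]_{\bar f}-\frac{L}{\bar g^Y}[(a\bar f^Xb)gc]_{\bar g}$, $w=La\bar f^Xb\bar g^Xc$; (4) if $\bar f^Y\ne1$, for any $a,b$ with $a\bar f^Xb\in ALSW(X)$, $C_4\langle f\rangle_w=[[a\bar f^Xb],[afb]_{\bar f}]$, $w=\bar f^Y\,a\bar f^Xb\,a\bar f^Xb$. For $\mathbf{k}$-monic $S$ and $w\in[Y]X^*$, $h$ is trivial modulo $(S,w)$ if $h=\sum\alpha_i\beta_i[a_is_ib_i]_{\bar s_i}$, $\alpha_i\in\mathbf{k}$, $\beta_i\in[Y]$, $s_i\in S$, $\beta_i\bar s_i^Ya_i\bar s_i^Xb_i\prec w$. $S$ is a Gröbner–Shirshov basis in $Lie_{\mathbf{k}[Y]}(X)$ if all compositions $C_1,C_2,C_3$ of $f,g\in S$ and $C_4$ of $f\in S$ are trivial modulo $(S,w)$. All associative algebras have identity. For $S\subseteq Lie_{\mathbf{k}[Y]}(X)$,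 $Lie_K(X|S)$ is the free Lie $K$-algebra on $X$ modulo the ideal generated by the image of $S$ (coefficients reduced mod $Id(R)$); $U_K(\mathcal L)=K\langle X|S^{(-)}\rangle$ is the free associative $K$-algebra on $X$ modulo the ideal generated by $S^{(-)}$, the images of elements of $S$ with Lie brackets expanded as commutators $[u,v]=uv-vu$. *)

(* Defs.v *)
From HB Require Import structures.
From mathcomp Require Import all_boot all_order all_algebra.
From mathcomp Require Import finmap.
From mathcomp.multinomials Require Import monalg.
From Stdlib Require Import ClassicalEpsilon.

Set Implicit Arguments.
Unset Strict Implicit.
Unset Printing Implicit Defensive.

Import Order.TTheory GRing.Theory.
Local Open Scope ring_scope.

(* Lexicographic order on words, with the convention 1 > t (t <> 1):   *)
(* lexgt u v  <->  u > v.                                              *)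
Fixpoint lexgt {d : Order.disp_t} {T : orderType d} (u v : seq T) : bool :=
  match u, v with
  | [::], [::] => false
  | [::], _ :: _ => true
  | _ :: _, [::] => false
  | x :: u', y :: v' => (y < x)%O || ((x == y) && lexgt u' v')
  end.

Definition dlgt {d : Order.disp_t} {T : orderType d} (u v : seq T) : bool :=
  (size v < size u)%N || ((size u == size v) && lexgt u v).

Definition well_ordered {d : Order.disp_t} (T : orderType d) : Prop :=
  well_founded (fun a b : T => (a < b)%O).

Section GSB.
Context {k : fieldType} {dX dY : Order.disp_t} {X : orderType dX} {Y : orderType dY}.

Definition kY := {malg k[{cmonom Y}]}.
Definition kYX := {malg kY[{fmonom X}]}.

Definition wrd (w : seq X) : kYX := << FMonom w >>.
Definition ymon (m : {cmonom Y}) : kY := << m >>.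

Definition lie (f g : kYX) : kYX := f * g - g * f.

(* Lie_{k[Y]}(X): the k[Y]-Lie subalgebra of k[Y]<X> generated by X. *)
Inductive inLie : kYX -> Prop :=
| inLie_gen (x : X) : inLie (wrd [:: x])
| inLie_0 : inLie 0
| inLie_add f g : inLie f -> inLie g -> inLie (f + g)
| inLie_scale (c : kY) f : inLie f -> inLie (c *: f)
| inLie_br f g : inLie f -> inLie g -> inLie (lie f g).

(* deg-lex order on [Y]: total degree, then lex order of the
   nonincreasingly sorted word of variables (= lex on exponents). *)
Definition cm_seq (m : {cmonom Y}) : seq Y :=
  sort (fun a b => (b <= a)%O)
       (flatten [seq nseq (m y) y | y <- enum_fset (finsupp m)]).
Definition dlgtY (m m' : {cmonom Y}) : bool := dlgt (cm_seq m) (cm_seq m').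

Definition mgt (u v : {cmonom Y} * seq X) : bool :=
  dlgt u.2 v.2 || ((u.2 == v.2) && dlgtY u.1 v.1).

Definition argmax {T : Type} (gt : T -> T -> bool) (x0 : T) (s : seq T) : T :=
  foldr (fun x m => if gt x m then x else m) (head x0 s) s.

Definition lwX (f : kYX) : seq X :=
  fmonom_val (argmax (fun a b : {fmonom X} => dlgt (fmonom_val a) (fmonom_val b))
                     (FMonom [::]) (msupp f)).
Definition lwY (f : kYX) : {cmonom Y} :=
  argmax dlgtY (onecm Y) (msupp (f@_(FMonom (lwX f)))).
Definition lcoef (f : kYX) : k := (f@_(FMonom (lwX f)))@_(lwY f).

Definition kmonic (f : kYX) : Prop := f != 0 /\ lcoef f = 1.

Definition alsw (w : seq X) : bool :=
  (w != [::]) &&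
  all (fun i => lexgt w (drop i w ++ take i w)) (iota 1 (size w).-1).

(* bracket trees; BHole is a placeholder to be replaced by an element s *)
Inductive btree := BLeaf of X | BHole | BNode of btree & btree.

Fixpoint bword (t : btree) : seq X :=
  match t with BLeaf x => [:: x] | BHole => [::] | BNode l r => bword l ++ bword r end.

Fixpoint beval (s : kYX) (t : btree) : kYX :=
  match t with
  | BLeaf x => wrd [:: x]
  | BHole => s
  | BNode l r => lie (beval s l) (beval s r)
  end.

(* length of the prefix u in w = uv, v the longest proper ALSW suffix *)
Definition std_split (w : seq X) : nat :=
  (find (fun j => alsw (drop j w)) (iota 1 (size w).-1)).+1.

Fixpoint stdt (n : nat) (w : seq X) : btree :=
  match w, n with
  | [:: x], _ => BLeaf x
  | _, n'.+1 => BNode (stdt n' (take (std_split w) w)) (stdt n' (drop (std_split w) w))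
  | _, 0 => BHole
  end.

Definition std_tree (w : seq X) : btree := stdt (size w) w.
Definition bracket (w : seq X) : kYX := beval 0 (std_tree w).

Definition is_fact (c : seq X) (l : seq (seq X)) : bool :=
  [&& flatten l == c, all alsw l & sorted (fun p q => (p == q) || lexgt q p) l].
Definition fact (c : seq X) : seq (seq X) :=
  epsilon (inhabits [::]) (fun l => is_fact c l).

(* In tree t (whose leaves start at offset off), replace the smallest
   sub-bracket starting at position i and of length >= m, whose word is
   u c with |u| = m, by N c. *)
Fixpoint splice (i m : nat) (N : seq X -> btree) (t : btree) (off : nat) : btree :=
  match t with
  | BNode l r =>
      let sl := size (bword l) in
      if off == i then
        (if (m <= sl)%N then BNode (splice i m N l off) r else N (drop m (bword t)))
      else if (i < off + sl)%N then BNode (splice i m N l off) r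
      else BNode l (splice i m N r (off + sl))
  | _ => if off == i then N (drop m (bword t)) else t
  end.

(* [a u b]_u with [u] replaced by a hole when hole = true *)
Definition spec_tree (hole : bool) (a u b : seq X) : btree :=
  splice (size a) (size u)
    (fun c => foldl (fun t c' => BNode t (std_tree c')) (if hole then BHole else std_tree u) (fact c))
    (std_tree (a ++ u ++ b)) 0.

Definition nsw (s : kYX) (a b : seq X) : kYX := beval s (spec_tree true a (lwX s) b).

Definition lcmcm (m1 m2 : {cmonom Y}) : {cmonom Y} :=
  [cmonom maxn (m1 i) (m2 i) | i in finsupp m1 `|` finsupp m2]%M.
Definition gcdcm (m1 m2 : {cmonom Y}) : {cmonom Y} :=
  [cmonom minn (m1 i) (m2 i) | i in finsupp m1 `|` finsupp m2]%M.

Record sterm := STerm { st_c : k; st_m : {cmonom Y}; st_s : kYX; st_a : seq X; st_b : seq X }.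

Definition trivial_mod (S : kYX -> Prop) (h : kYX) (w : {cmonom Y} * seq X) : Prop :=
  exists l : seq sterm,
    (forall t, List.In t l ->
       [/\ S (st_s t), alsw (st_a t ++ lwX (st_s t) ++ st_b t) &
           mgt w (mulcm (st_m t) (lwY (st_s t)), st_a t ++ lwX (st_s t) ++ st_b t)]) /\
    h = \sum_(t <- l) << st_c t *g st_m t >> *: nsw (st_s t) (st_a t) (st_b t).

Definition C1 (f g : kYX) (a b : seq X) : kYX :=
  let L := lcmcm (lwY f) (lwY g) in
  ymon (divcm L (lwY f)) *: f - ymon (divcm L (lwY g)) *: nsw g a b.
Definition C2 (f g : kYX) (a b : seq X) : kYX :=
  let L := lcmcm (lwY f) (lwY g) in
  ymon (divcm L (lwY f)) *: nsw f [::] b - ymon (divcm L (lwY g)) *: nsw g a [::].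
Definition C3 (f g : kYX) (a b c : seq X) : kYX :=
  let L := lcmcm (lwY f) (lwY g) in
  ymon (divcm L (lwY f)) *: nsw f a (b ++ lwX g ++ c)
  - ymon (divcm L (lwY g)) *: nsw g (a ++ lwX f ++ b) c.
Definition C4 (f : kYX) (a b : seq X) : kYX :=
  lie (bracket (a ++ lwX f ++ b)) (nsw f a b).

Definition GSB (S : kYX -> Prop) : Prop :=
  (forall s, S s -> kmonic s) /\
  (forall f g, S f -> S g ->
     let L := lcmcm (lwY f) (lwY g) in
     [/\ (forall a b, lwX f = a ++ lwX g ++ b ->
            trivial_mod S (C1 f g a b) (L, lwX f)),
         (forall a a0 b, a != [::] -> a0 != [::] -> b != [::] ->
            lwX f = a ++ a0 -> lwX g = a0 ++ b ->
            trivial_mod S (C2 f g a b) (L, lwX f ++ b)) &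
         (gcdcm (lwY f) (lwY g) != onecm Y ->
          forall a b c, alsw (a ++ lwX f ++ b ++ lwX g ++ c) ->
            trivial_mod S (C3 f g a b c) (L, a ++ lwX f ++ b ++ lwX g ++ c))]) /\
  (forall f, S f -> lwY f != onecm Y ->
     forall a b, alsw (a ++ lwX f ++ b) ->
       trivial_mod S (C4 f a b) (lwY f, (a ++ lwX f ++ b) ++ (a ++ lwX f ++ b))).

Definition kYmonic (f : kYX) : Prop :=
  exists (u1 : seq X) (l : seq (kY * seq X)),
    [/\ f = bracket u1 + \sum_(p <- l) p.1 *: bracket p.2,
        alsw u1, all (fun p => alsw p.2 && (p.1 != 0)) l &
        sorted (fun p q : kY * seq X => dlgt p.2 q.2) ((1, u1) :: l)].

Definition inId (R : kY -> Prop) (c : kY) : Prop :=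
  exists l : seq (kY * kY), (forall p, List.In p l -> R p.2) /\
    c = \sum_(p <- l) p.1 * p.2.

Inductive lexp :=
| LGen of X | LZero | LAdd of lexp & lexp | LScale of kY & lexp | LBr of lexp & lexp.

Fixpoint leval (e : lexp) : kYX :=
  match e with
  | LGen x => wrd [:: x]
  | LZero => 0
  | LAdd e1 e2 => leval e1 + leval e2
  | LScale c e1 => c *: leval e1
  | LBr e1 e2 => lie (leval e1) (leval e2)
  end.

Inductive aexp :=
| AGen of X | AZero | AOne | AAdd of aexp & aexp | AScale of kY & aexp | AMul of aexp & aexp.

Fixpoint ltoa (e : lexp) : aexp :=
  match e with
  | LGen x => AGen x
  | LZero => AZero
  | LAdd e1 e2 => AAdd (ltoa e1) (ltoa e2)
  | LScale c e1 => AScale c (ltoa e1)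
  | LBr e1 e2 => AAdd (AMul (ltoa e1) (ltoa e2)) (AScale (-1) (AMul (ltoa e2) (ltoa e1)))
  end.

(* Equality in Lie_K(X|S): the congruence generated by the axioms of Lie
   K-algebras (K = k[Y]/Id(R)) and the relations s = 0, s in S. *)
Inductive LEq (R : kY -> Prop) (S : kYX -> Prop) : lexp -> lexp -> Prop :=
| LEq_refl e : LEq R S e e
| LEq_sym e1 e2 : LEq R S e1 e2 -> LEq R S e2 e1
| LEq_trans e1 e2 e3 : LEq R S e1 e2 -> LEq R S e2 e3 -> LEq R S e1 e3
| LEq_add e1 e2 e1' e2' : LEq R S e1 e1' -> LEq R S e2 e2' -> LEq R S (LAdd e1 e2) (LAdd e1' e2')
| LEq_scale c e e' : LEq R S e e' -> LEq R S (LScale c e) (LScale c e')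
| LEq_br e1 e2 e1' e2' : LEq R S e1 e1' -> LEq R S e2 e2' -> LEq R S (LBr e1 e2) (LBr e1' e2')
| LEq_addA e1 e2 e3 : LEq R S (LAdd e1 (LAdd e2 e3)) (LAdd (LAdd e1 e2) e3)
| LEq_addC e1 e2 : LEq R S (LAdd e1 e2) (LAdd e2 e1)
| LEq_add0 e : LEq R S (LAdd LZero e) e
| LEq_addN e : LEq R S (LAdd e (LScale (-1) e)) LZero
| LEq_scaleDl c d e : LEq R S (LScale (c + d) e) (LAdd (LScale c e) (LScale d e))
| LEq_scaleDr c e1 e2 : LEq R S (LScale c (LAdd e1 e2)) (LAdd (LScale c e1) (LScale c e2))
| LEq_scaleA c d e : LEq R S (LScale (c * d) e) (LScale c (LScale d e))
| LEq_scale1 e : LEq R S (LScale 1 e) e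
| LEq_coefId c d e : inId R (c - d) -> LEq R S (LScale c e) (LScale d e)
| LEq_brDl e1 e2 e3 : LEq R S (LBr (LAdd e1 e2) e3) (LAdd (LBr e1 e3) (LBr e2 e3))
| LEq_brDr e1 e2 e3 : LEq R S (LBr e1 (LAdd e2 e3)) (LAdd (LBr e1 e2) (LBr e1 e3))
| LEq_brZl c e1 e2 : LEq R S (LBr (LScale c e1) e2) (LScale c (LBr e1 e2))
| LEq_brZr c e1 e2 : LEq R S (LBr e1 (LScale c e2)) (LScale c (LBr e1 e2))
| LEq_alt e : LEq R S (LBr e e) LZero
| LEq_jacobi e1 e2 e3 :
    LEq R S (LAdd (LAdd (LBr (LBr e1 e2) e3) (LBr (LBr e2 e3) e1)) (LBr (LBr e3 e1) e2)) LZero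
| LEq_rel e : S (leval e) -> LEq R S e LZero.

(* Equality in U_K = K<X | S^(-)>: the congruence generated by the axioms
   of associative unital K-algebras and the relations s^(-) = 0, s in S. *)
Inductive AEq (R : kY -> Prop) (S : kYX -> Prop) : aexp -> aexp -> Prop :=
| AEq_refl e : AEq R S e e
| AEq_sym e1 e2 : AEq R S e1 e2 -> AEq R S e2 e1
| AEq_trans e1 e2 e3 : AEq R S e1 e2 -> AEq R S e2 e3 -> AEq R S e1 e3
| AEq_add e1 e2 e1' e2' : AEq R S e1 e1' -> AEq R S e2 e2' -> AEq R S (AAdd e1 e2) (AAdd e1' e2')
| AEq_scale c e e' : AEq R S e e' -> AEq R S (AScale c e) (AScale c e')
| AEq_mul e1 e2 e1' e2' : AEq R S e1 e1' -> AEq R S e2 e2' -> AEq R S (AMul e1 e2) (AMul e1' e2')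
| AEq_addA e1 e2 e3 : AEq R S (AAdd e1 (AAdd e2 e3)) (AAdd (AAdd e1 e2) e3)
| AEq_addC e1 e2 : AEq R S (AAdd e1 e2) (AAdd e2 e1)
| AEq_add0 e : AEq R S (AAdd AZero e) e
| AEq_addN e : AEq R S (AAdd e (AScale (-1) e)) AZero
| AEq_scaleDl c d e : AEq R S (AScale (c + d) e) (AAdd (AScale c e) (AScale d e))
| AEq_scaleDr c e1 e2 : AEq R S (AScale c (AAdd e1 e2)) (AAdd (AScale c e1) (AScale c e2))
| AEq_scaleA c d e : AEq R S (AScale (c * d) e) (AScale c (AScale d e))
| AEq_scale1 e : AEq R S (AScale 1 e) e
| AEq_coefId c d e : inId R (c - d) -> AEq R S (AScale c e) (AScale d e)
| AEq_mulA e1 e2 e3 : AEq R S (AMul e1 (AMul e2 e3)) (AMul (AMul e1 e2) e3)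
| AEq_mul1l e : AEq R S (AMul AOne e) e
| AEq_mul1r e : AEq R S (AMul e AOne) e
| AEq_mulDl e1 e2 e3 : AEq R S (AMul (AAdd e1 e2) e3) (AAdd (AMul e1 e3) (AMul e2 e3))
| AEq_mulDr e1 e2 e3 : AEq R S (AMul e1 (AAdd e2 e3)) (AAdd (AMul e1 e2) (AMul e1 e3))
| AEq_mulZl c e1 e2 : AEq R S (AMul (AScale c e1) e2) (AScale c (AMul e1 e2))
| AEq_mulZr c e1 e2 : AEq R S (AMul e1 (AScale c e2)) (AScale c (AMul e1 e2))
| AEq_rel e : S (leval e) -> AEq R S (ltoa e) AZero.

(* the canonical K-linear map Lie_K(X|S) -> U_K(Lie_K(X|S)), x |-> x,
   is injective *)
Definition embeds_in_UEA (R : kY -> Prop) (S : kYX -> Prop) : Prop :=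
  forall e1 e2 : lexp, AEq R S (ltoa e1) (ltoa e2) -> LEq R S e1 e2.

End GSB.

(* Main.v *)
Require Import Defs.
From HB Require Import structures.
From mathcomp Require Import all_boot all_order all_algebra.
From mathcomp Require Import finmap.
From mathcomp.multinomials Require Import monalg.
From mathcomp Require Import zify.
From Stdlib Require Import Setoid Morphisms.

(** Elements of [S] are monic over [A = k[Y]], so their leading monomials lie in
    [X^*] and only the compositions [C1] and [C2] matter. Because the word of
    every bracket of a normal s-word beats its rotation, such an s-word equals
    [a s b] plus terms [a' s b'] with smaller leading words; hence [S] is also an
    associative Groebner-Shirshov basis, and the composition-diamond lemma holds
    modulo the ideal [I = Id(R)] of coefficients: the largest word whose
    coefficient in an element of [Id(S) + I A<X>] is not in [I] contains some
    leading word of [S]. A Lie element [e] lying in [Id(S) + I A<X>] is a combination of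
    standard brackets [[u]]; let [c [V]] be its leading term. If [c] is in [I] the
    term vanishes in [Lie_K(X|S)]; otherwise [V = a s b] on leading words, and
    subtracting [c] times the normal s-word lowers the leading word. By
    well-founded induction [e] vanishes in [Lie_K(X|S)]. *)

Set Implicit Arguments.
Unset Strict Implicit.
Unset Printing Implicit Defensive.

Import Order.TTheory GRing.Theory.
Local Open Scope ring_scope.

(** * Lyndon words and standard bracketings *)

Section Words.
Context {d : Order.disp_t} {T : orderType d}.
Implicit Types u v w a b c p q r : seq T.

(** * The lexicographic order, its behaviour under multiplication, and ALSWs *)

Definition lexge u v := (u == v) || lexgt u v.

Lemma lexgt_irr u : lexgt u u = false.
Proof. by elim: u => //= x u ->; rewrite ltxx andbF. Qed.

Lemma lexgt_trans v u w : lexgt u v -> lexgt v w -> lexgt u w.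
Proof.
elim: u v w => [|x u IH] [|y v] [|z w] //=.
case/orP=> [yx|/andP[/eqP<- uv]]; case/orP=> [zy|/andP[/eqP<- vw]].
- by rewrite (lt_trans zy yx).
- by rewrite yx.
- by rewrite zy.
- by rewrite eqxx (IH _ _ uv vw) orbT.
Qed.

Lemma lexgt_total u v : [|| u == v, lexgt u v | lexgt v u].
Proof.
elim: u v => [|x u IH] [|y v] //=.
rewrite eqseq_cons; by case: (ltgtP x y) => /=.
Qed.

Lemma lexge_refl u : lexge u u. Proof. by rewrite /lexge eqxx. Qed.

Lemma lexgtW u v : lexgt u v -> lexge u v.
Proof. by rewrite /lexge orbC => ->. Qed.

Lemma lexge_gt_trans v u w : lexge u v -> lexgt v w -> lexgt u w.
Proof. by case/orP=> [/eqP->//|]; apply: lexgt_trans. Qed.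

Lemma lexgt_ge_trans v u w : lexgt u v -> lexge v w -> lexgt u w.
Proof. by move=> uv /orP[/eqP<-//|]; apply: lexgt_trans. Qed.

Lemma lexge_trans v u w : lexge u v -> lexge v w -> lexge u w.
Proof. by move=> uv /orP[/eqP<-//|vw]; apply/lexgtW/(lexge_gt_trans uv). Qed.

Lemma lexgtN u v : ~~ lexgt u v = lexge v u.
Proof.
have:= lexgt_total u v; rewrite /lexge eq_sym.
case: eqP => [->|_] /=; first by rewrite lexgt_irr.
case: (boolP (lexgt u v)) => //= uv _; apply/esym/negbTE/negP => vu.
by have:= lexgt_trans uv vu; rewrite lexgt_irr.
Qed.

Lemma lexgt_asym u v : lexgt u v -> lexgt v u = false.
Proof. by move=> uv; apply/negbTE; rewrite lexgtN lexgtW. Qed.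

Lemma lexgt_cat2l p u v : lexgt (p ++ u) (p ++ v) = lexgt u v.
Proof. by elim: p => //= x p ->; rewrite ltxx eqxx. Qed.

Lemma lexge_cat2l p u v : lexge (p ++ u) (p ++ v) = lexge u v.
Proof. by rewrite /lexge eqseq_cat // eqxx lexgt_cat2l. Qed.

Lemma lexge_prefix u v : lexge u (u ++ v).
Proof. by rewrite -{1}[u]cats0 lexge_cat2l; case: v. Qed.

(* [u > v] is decided at a letter unless [u] is a prefix of [v], and then it
   survives any right multiplication. *)
Lemma lexgt_catP u v : lexgt u v ->
  (exists2 w, w != [::] & v = u ++ w) \/
  (forall p q, lexgt (u ++ p) (v ++ q)).
Proof.
elim: u v => [|x u IH] [|y v] //=; first by move=> _; left; exists (y :: v).
case/orP=> [yx|/andP[/eqP<- uv]]; first by right=> p q; rewrite yx.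
case: (IH _ uv) => [[w wn ->]|H]; first by left; exists w.
by right=> p q; rewrite eqxx H orbT.
Qed.

Lemma lexgt_cat u v p q : lexgt u v -> (size v <= size u)%N ->
  lexgt (u ++ p) (v ++ q).
Proof.
move=> uv; case: (lexgt_catP uv) => [[w wn ->]|//].
by rewrite size_cat; case: w wn => //= x w _ ?; lia.
Qed.

(** From suffixes to rotations: [w > b] survives appending to [b], which is no longer than [w].
    Conversely a proper suffix [b >= w] violates the rotation that moves [b] to the front or, if [b]
    is also a prefix of [w], the rotation at that prefix. *)
Lemma alswP w : reflect
  (w <> [::] /\ forall a b, a != [::] -> b != [::] -> w = a ++ b -> lexgt w b)
  (alsw w).
Proof.
apply: (iffP andP) => [[/eqP wn /allP H]|[wn H]]; last first.
  split; first exact/eqP.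
  apply/allP=> i; rewrite mem_iota => /andP[i0 iw].
  have sw : (i < size w)%N by case: (w) wn iw => //= *; lia.
  rewrite -[X in lexgt X _]cats0; apply: lexgt_cat; last first.
    by rewrite size_drop leq_subr.
  apply: (H (take i w)); last by rewrite cat_take_drop.
  - by rewrite -size_eq0 size_takel -?lt0n // ltnW.
  - by rewrite -size_eq0 size_drop -lt0n subn_gt0.
split=> //.
have R a b : a != [::] -> b != [::] -> w = a ++ b -> lexgt w (b ++ a).
  move=> an bn E; have:= H (size a); rewrite E drop_size_cat // take_size_cat //.
  apply; rewrite mem_iota lt0n size_eq0 an /=.
  have:= size_cat a b; case: (a) an => // x a' _; case: (b) bn => // y b' _ /=.
  by rewrite size_cat /=; lia.
move=> a b an bn E; rewrite -[lexgt _ _]negbK lexgtN; apply/negP.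
case/orP=> [/eqP|] bw.
  by move: an; rewrite E in bw; rewrite -size_eq0 -(addnK (size b) (size a)) -size_cat -bw subnn.
(* In the prefix case [w = ab = bc]: the rotation [ab > ba] gives [c > a], so [cb > ab = w] as
   [|a| = |c|], against the rotation [bc > cb]. *)
case: (lexgt_catP bw) => [[c cn E']|/(_ a [::])]; last first.
  by rewrite cats0 => /lexgt_asym; rewrite R.
have ba := R _ _ an bn E; have cb := R _ _ bn cn E'.
move: ba; rewrite E' lexgt_cat2l => ca.
have sz : size a = size c.
  by apply/eqP; rewrite -(eqn_add2r (size b)) -size_cat -E E' size_cat addnC.
have := lexgt_cat b b ca; rewrite sz -E => /(_ (leqnn _)) /lexgt_asym.
by rewrite cb.
Qed.

Lemma alsw_neq0 w : alsw w -> w != [::].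
Proof. by case/alswP => /eqP. Qed.

Lemma alsw_suffix a b : alsw (a ++ b) -> b != [::] -> lexge (a ++ b) b.
Proof.
case/alswP=> _ H bn; case: (eqVneq a [::]) => [->|an]; first exact: lexge_refl.
exact/lexgtW/(H a).
Qed.

Lemma alsw_suffix_lt a b : alsw (a ++ b) -> a != [::] -> b != [::] ->
  lexgt (a ++ b) b.
Proof. by case/alswP=> _ H an bn; apply: (H a). Qed.

Lemma alsw_rot a b : alsw (a ++ b) -> a != [::] -> b != [::] ->
  lexgt (a ++ b) (b ++ a).
Proof.
move=> H an bn; rewrite -[X in lexgt X _]cats0; apply: lexgt_cat.
  exact: alsw_suffix_lt.
by rewrite size_cat leq_addl.
Qed.

Lemma cat_eq_split a b p q : a ++ b = p ++ q ->
  (exists r, p = a ++ r /\ b = r ++ q) \/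
  (exists2 r, r != [::] & a = p ++ r /\ q = r ++ b).
Proof.
elim: a p => [|x a IH] [|y p] //=.
- by move=> ->; left; exists [::].
- by move=> ->; left; exists (y :: p).
- by move=> <-; right; exists (x :: a).
case=> <- /IH [[r [-> ->]]|[r rn [-> ->]]]; first by left; exists r.
by right; exists r.
Qed.

Lemma size_neq0 u : u != [::] -> (0 < size u)%N.
Proof. by case: u. Qed.

(** The delicate case is [v = uw]: cancelling [u] leaves [v > w] with [w] a proper suffix of the
    ALSW [v]. *)
Lemma alsw_cat_lt u v : alsw u -> alsw v -> lexgt u v -> lexgt (u ++ v) v.
Proof.
move=> Hu Hv uv; case: (lexgt_catP uv) => [[w wn E]|/(_ v [::])]; last first.
  by rewrite cats0.
rewrite [X in lexgt _ X]E lexgt_cat2l E; apply: alsw_suffix_lt => //.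
  by rewrite -E.
exact: alsw_neq0.
Qed.

Lemma alsw_cat u v : alsw u -> alsw v -> lexgt u v -> alsw (u ++ v).
Proof.
move=> Hu Hv uv; have L := alsw_cat_lt Hu Hv uv.
have un := alsw_neq0 Hu.
apply/alswP; split; first by case: (u) un.
move=> a b an bn /cat_eq_split[[r [E1 E2]]|[r rn [E1 E2]]].
  by apply: (lexgt_ge_trans L); rewrite E2; apply: alsw_suffix; rewrite -?E2.
rewrite E2; apply: lexgt_cat; last by rewrite E1 size_cat leq_addl.
by rewrite E1; apply: alsw_suffix_lt; rewrite -?E1.
Qed.

(** A suffix starting inside [qr] is at most [qr], which is below [pqr] because [pq > q]; one
    starting inside [p] is a proper suffix of [pq] followed by [r]. *)
Lemma alsw_overlap p q r : q != [::] -> alsw (p ++ q) -> alsw (q ++ r) ->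
  alsw (p ++ q ++ r).
Proof.
move=> qn H1 H2; case: (eqVneq p [::]) => [->//|pn].
apply/alswP; split; first by case: (p) pn.
move=> a b an bn /cat_eq_split[[s [E1 E2]]|[s sn [E1 E2]]].
  apply: (@lexgt_ge_trans (q ++ r)); last first.
    by rewrite E2; apply: alsw_suffix; rewrite -?E2.
  rewrite catA; apply: lexgt_cat; first exact: alsw_suffix_lt.
  by rewrite size_cat leq_addl.
rewrite E2 !catA; apply: lexgt_cat; last by rewrite E1 !size_cat; lia.
rewrite E1 -catA; apply: alsw_suffix_lt => //; first by rewrite catA -E1.
by case: (s) sn.
Qed.

(** Letters are added on the left: the new ALSW [u] absorbs the first factor as long as [u] is the
    larger one, and the product remains an ALSW. *)
Lemma fact_exists c : exists l, is_fact c l.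
Proof.
elim: c => [|x c [l Hl]]; first by exists [::].
suff I n u l' c' : size l' = n -> alsw u -> is_fact c' l' ->
    exists l, is_fact (u ++ c') l by apply: (I _ [:: x] l).
elim: n u l' c' {x c l Hl} => [|n IH] u [|v l] c //=.
- by move=> _ Hu /and3P[/eqP<- _ _]; exists [:: u]; rewrite /is_fact /= Hu !eqxx.
- case=> sl Hu /and3P[/eqP<- /= /andP[Hv Hl] S].
  case: (boolP (lexgt u v)) => uv; last first.
    exists [:: u, v & l]; rewrite /is_fact /= eqxx Hu Hv Hl /= S andbT.
    by move: uv; rewrite lexgtN /lexge eq_sym.
  rewrite catA; apply: (IH _ l); rewrite ?alsw_cat //.
  by rewrite /is_fact eqxx Hl /= (path_sorted S).
Qed.

Lemma factP c : is_fact c (fact c).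
Proof. exact: ClassicalEpsilon.epsilon_spec (fact_exists c). Qed.

Lemma sorted_fact_last (c1 : seq T) l :
  path (fun p q => (p == q) || lexgt q p) c1 l ->
  {in c1 :: l, forall c, lexge (last c1 l) c}.
Proof.
elim: l c1 => [|c2 l IH] c1 /=.
  by move=> _ c; rewrite inE => /eqP->; rewrite lexge_refl.
case/andP=> H /IH H' c; rewrite inE => /predU1P[->|/H'//].
apply: (lexge_trans (H' c2 (mem_head _ _))).
by move: H; rewrite /lexge eq_sym.
Qed.

Lemma alsw_ends p : p != [::] -> exists p1 r1 p2 r2,
  [/\ alsw p1, alsw p2, p = p1 ++ r1, p = r2 ++ p2 & lexge p2 p1].
Proof.
case: (fact_exists p) => -[|c1 l] /and3P[/eqP<- //= /andP[H1 Hl] S] _.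
exists c1, (flatten l), (last c1 l), (flatten (belast c1 l)); split=> //.
- by case: (lastP l) Hl => [//|l' z]; rewrite all_rcons last_rcons => /andP[].
- by rewrite -[LHS]/(flatten (c1 :: l)) lastI -cats1 flatten_cat /= cats0.
- exact: sorted_fact_last (mem_head _ _).
Qed.

(** * Standard factorizations *)

Definition longest_suffix u v :=
  forall p q, p != [::] -> q != [::] -> u = p ++ q -> ~~ alsw (q ++ v).

(** If [u] had several factors, with first [p1] and last [p2 >= p1], maximality of [v] would exclude
    [p2 > v], so [uv > v >= p2 >= p1]; but the prefix [p1] is at least [uv]. *)
Lemma std_left_alsw u v : u != [::] -> alsw v -> alsw (u ++ v) ->
  longest_suffix u v -> alsw u.
Proof.
move=> un Hv Huv L; have vn := alsw_neq0 Hv.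
case: (alsw_ends un) => p1 [r1 [p2 [r2 [A1 A2 E1 E2 G]]]].
case: (eqVneq r2 [::]) => [r0|rn]; first by rewrite E2 r0.
have := L _ _ rn (alsw_neq0 A2) E2.
case: (boolP (lexgt p2 v)) => [/(alsw_cat A2 Hv)->//|].
rewrite lexgtN => vp _.
have := alsw_suffix_lt Huv un vn.
move/lexgt_ge_trans/(_ (lexge_trans vp G)).
by rewrite E1 -catA -[lexgt _ _]negbK lexgtN lexge_prefix.
Qed.

Inductive std_spec w : nat -> Prop :=
  StdSpec u v of w = u ++ v & u != [::] & alsw u & alsw v & longest_suffix u v :
    std_spec w (size u).

Lemma std_splitP w : alsw w -> (1 < size w)%N -> std_spec w (std_split w).
Proof.
move=> Hw sw; rewrite /std_split.
set P := fun j => alsw (drop j w); set s := iota 1 (size w).-1.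
have hs : has P s.
  (* The last letter is an ALSW, so the search succeeds; it scans from the left, so its first hit is
     the longest proper ALSW suffix. *)
  apply/hasP; exists (size w).-1; first by rewrite mem_iota; lia.
  rewrite /P; have: size (drop (size w).-1 w) = 1%N by rewrite size_drop; lia.
  by case: drop => // x [|].
set f := find P s; have fs : (f < (size w).-1)%N by move: hs; rewrite has_find size_iota.
have Pf : alsw (drop f.+1 w) by have := nth_find 0%N hs; rewrite nth_iota.
have B j : (0 < j)%N -> (j < f.+1)%N -> ~~ alsw (drop j w).
  move=> j0 jf; have := @before_find _ 0%N P s j.-1.
  rewrite nth_iota; last by rewrite -/f in fs; lia.
  by rewrite /P add1n prednK // => -> //; rewrite -/f; lia.
have E : w = take f.+1 w ++ drop f.+1 w by rewrite cat_take_drop.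
have su : size (take f.+1 w) = f.+1 by rewrite size_takel; lia.
have L : longest_suffix (take f.+1 w) (drop f.+1 w).
  move=> p q pn qn E'; have := B (size p) (size_neq0 pn).
  have -> : drop (size p) w = q ++ drop f.+1 w by rewrite {1}E E' -catA drop_size_cat.
  apply; have := congr1 size E'; rewrite su size_cat => ->.
  by have := size_neq0 qn; lia.
have un : take f.+1 w != [::] by rewrite -size_eq0 su.
rewrite -su; apply: (StdSpec E un _ Pf L).
by apply: (std_left_alsw un Pf _ L); rewrite cat_take_drop.
Qed.

(** Were [qv] an ALSW, the last factor of [q] would be a suffix of [u2] by maximality, so the first
    factor [p1] of [q] would satisfy [p1 <= u2 <= v < qv], although [p1] is a prefix of [qv]. *)
Lemma longest_suffix_cat u1 u2 v : u1 != [::] -> alsw u2 -> longest_suffix u1 u2 ->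
  alsw v -> lexge v u2 -> longest_suffix (u1 ++ u2) v.
Proof.
move=> u1n H2 L Hv vu p q pn qn E; apply/negP => Hqv.
case: (alsw_ends qn) => p1 [r1 [p2 [r2 [A1 A2 E1 E2 G]]]].
have up2 : lexge u2 p2.
  move: E; rewrite E2 catA => /cat_eq_split[[r [_ Er]]|[r rn [Er Er']]].
    by rewrite Er; apply: alsw_suffix (alsw_neq0 A2); rewrite -Er.
  have pr : p ++ r2 != [::] by case: (p) pn.
  by have := L _ _ pr rn Er; rewrite -Er' A2.
have := alsw_suffix_lt Hqv qn (alsw_neq0 Hv).
move/lexgt_ge_trans/(_ (lexge_trans (lexge_trans vu up2) G)).
by rewrite E1 -catA -[lexgt _ _]negbK lexgtN lexge_prefix.
Qed.

Lemma longest_suffix1 (x : T) v : longest_suffix [:: x] v.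
Proof. by move=> [|y [|z p]] [|t q]. Qed.

(** * The deg-lex order on words *)

Lemma dlgt_irr u : dlgt u u = false.
Proof. by rewrite /dlgt ltnn eqxx lexgt_irr. Qed.

Lemma dlgt_trans v u w : dlgt u v -> dlgt v w -> dlgt u w.
Proof.
rewrite /dlgt => /orP[a|/andP[/eqP a b]] /orP[c|/andP[/eqP e f]].
- by rewrite (ltn_trans c a).
- by rewrite -e a.
- by rewrite a c.
- by rewrite a e eqxx (lexgt_trans b f) orbT.
Qed.

Definition dlge u v := (u == v) || dlgt u v.

Lemma dlgt_total u v : dlgt u v \/ dlge v u.
Proof.
rewrite /dlge /dlgt [v == u]eq_sym [size v == _]eq_sym.
case: (ltngtP (size u) (size v)) => //=; rewrite ?orbT ?orbF; auto.
by move=> _; have := lexgt_total u v => /or3P[]->; rewrite ?orbT; auto.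
Qed.

Lemma dlge_gt_trans v u w : dlge u v -> dlgt v w -> dlgt u w.
Proof. by case/orP=> [/eqP->//|]; apply: dlgt_trans. Qed.

Lemma dlgt_ge_trans v u w : dlgt u v -> dlge v w -> dlgt u w.
Proof. by move=> uv /orP[/eqP<-//|]; apply: dlgt_trans. Qed.

Lemma dlge_trans v u w : dlge u v -> dlge v w -> dlge u w.
Proof. by move=> uv /orP[/eqP<-//|vw]; rewrite /dlge (dlge_gt_trans uv vw) orbT. Qed.

Lemma dlge_refl u : dlge u u. Proof. by rewrite /dlge eqxx. Qed.

Lemma dlgtW u v : dlgt u v -> dlge u v.
Proof. by rewrite /dlge orbC => ->. Qed.

Lemma dlgt_cat2 p q u v : dlgt u v -> dlgt (p ++ u ++ q) (p ++ v ++ q).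
Proof.
rewrite /dlgt !size_cat ltn_add2l ltn_add2r eqn_add2l eqn_add2r lexgt_cat2l.
by case/orP=> [->//|/andP[/eqP E uv]]; rewrite E ltnn eqxx lexgt_cat ?E.
Qed.

Lemma dlgt_catl p u v : dlgt u v -> dlgt (p ++ u) (p ++ v).
Proof. by move/(dlgt_cat2 p [::]); rewrite !cats0. Qed.

Lemma dlgt_catr q u v : dlgt u v -> dlgt (u ++ q) (v ++ q).
Proof. exact: dlgt_cat2 [::] q u v. Qed.

(** Lex alone is not well-founded, as [x > xx > xxx > ...]. At a fixed length it is, by induction on
    the first letter and then on the tail; induction on the length does the rest. *)
Lemma dlgt_wf : well_ordered T -> well_founded (fun v u => dlgt u v).
Proof.
move=> wfT.
pose R v u := (size v == size u) && lexgt u v.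
have wfR n : forall u, size u = n -> Acc R u.
  elim: n => [|n IH] u.
    move/size0nil->; constructor=> v; rewrite /R => /andP[/eqP/size0nil->].
    by rewrite lexgt_irr.
  case: u => [|x u]; first discriminate.
  move=> [sn]; elim: (wfT x) u sn => {}x _ IHx u su.
  have Au := IH _ su; elim: Au su => {}u _ IHu su.
  constructor=> -[|y v]; rewrite /R => /andP[/eqP]; first discriminate.
  move=> [svu] /= /orP[yx|/andP[/eqP xy uv]].
    by apply: (IHx _ yx); rewrite svu.
  rewrite -xy; apply: IHu; last by rewrite svu.
  by rewrite /R svu eqxx uv.
move=> u; have [n] := ubnP (size u); elim: n u => [//|n IH] u su.
elim: (wfR _ _ (erefl (size u))) su => {}u _ IHu su.
constructor=> v /orP[vu|/andP[/eqP E uv]].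
  by apply: IH; apply: leq_trans vu _; rewrite -ltnS.
apply: IHu; first by rewrite /R E eqxx uv.
by rewrite -E.
Qed.

(** The standard bracketing described node by node, without the fuel and the search of [stdt]; by
    [stdT_inj] such a tree is determined by its word. *)
Inductive stdT : btree -> Prop :=
| stdT_leaf (x : T) : stdT (BLeaf x)
| stdT_node (l r : btree) : stdT l -> stdT r -> alsw (bword l ++ bword r) ->
    longest_suffix (bword l) (bword r) -> stdT (BNode l r).

Lemma stdT_alsw t : stdT t -> alsw (bword t).
Proof. by case. Qed.

Lemma stdt_std n w : alsw w -> (size w <= n)%N ->
  stdT (stdt n w) /\ bword (stdt n w) = w.
Proof.
elim: n w => [|n IH] w Hw sw.
  by have:= alsw_neq0 Hw; rewrite -size_eq0 -leqn0 sw.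
case: (leqP (size w) 1) => [|w2].
  case: w Hw {sw} => [//|x [|//]] _ _; split=> //=; exact: stdT_leaf.
have -> : stdt n.+1 w = BNode (stdt n (take (std_split w) w)) (stdt n (drop (std_split w) w)).
  by case: w w2 {Hw sw} => [|x [|y w]].
case: (std_splitP Hw w2) => u v E un Hu Hv L.
have vn := alsw_neq0 Hv; have := size_neq0 un; have := size_neq0 vn => s1 s2.
rewrite E take_size_cat // drop_size_cat //.
have sE := congr1 size E; rewrite size_cat in sE.
have [|Su Eu] := IH u Hu; first by lia.
have [|Sv Ev] := IH v Hv; first by lia.
by split; [constructor; rewrite // Eu Ev // -E | rewrite /= Eu Ev].
Qed.

Lemma std_tree_std w : alsw w -> stdT (std_tree w).
Proof. by move=> Hw; case: (stdt_std Hw (leqnn _)). Qed.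

Lemma bword_std_tree w : alsw w -> bword (std_tree w) = w.
Proof. by move=> Hw; case: (stdt_std Hw (leqnn _)). Qed.

Lemma stdT_inj t1 t2 : stdT t1 -> stdT t2 -> bword t1 = bword t2 -> t1 = t2.
Proof.
move=> H1; elim: H1 t2 => [x|l r Hl IHl Hr IHr A L] t2 [y|l' r' Hl' Hr' A' L'] /=.
- by case=> ->.
- move/(congr1 size); rewrite size_cat /=.
  have := size_neq0 (alsw_neq0 (stdT_alsw Hl')); have := size_neq0 (alsw_neq0 (stdT_alsw Hr')).
  by lia.
- move/(congr1 size); rewrite size_cat /=.
  have := size_neq0 (alsw_neq0 (stdT_alsw Hl)); have := size_neq0 (alsw_neq0 (stdT_alsw Hr)).
  by lia.
have nl := alsw_neq0 (stdT_alsw Hl); have nl' := alsw_neq0 (stdT_alsw Hl').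
case/cat_eq_split=> [[q [E1 E2]]|[q qn [E1 E2]]]; last first.
  by have := L _ _ nl' qn E1; rewrite -E2 (stdT_alsw Hr').
case: (eqVneq q [::]) => [q0|qn]; last first.
  by have := L' _ _ nl qn E1; rewrite -E2 (stdT_alsw Hr).
by rewrite q0 cats0 /= in E1 E2; rewrite (IHl l') // (IHr r').
Qed.

(* [hol u t a b]: [t] is a bracketing of [aub] with a single hole in the place
   of the displayed [u], and the word of every bracket around it is an ALSW. *)
Inductive hol u : btree -> seq T -> seq T -> Prop :=
| hol_hole : hol u BHole [::] [::]
| hol_l (l r : btree) a b : hol u l a b -> stdT r -> alsw (a ++ u ++ b ++ bword r) ->
    hol u (BNode l r) a (b ++ bword r)
| hol_r (l r : btree) a b : stdT l -> hol u r a b -> alsw (bword l ++ a ++ u ++ b) ->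
    hol u (BNode l r) (bword l ++ a) b.

(** Every partial word [u c1 ... ci] is an ALSW: the next factor is below the whole word, hence
    below the partial word, since a prefix is at least as large as its extensions. *)
Lemma hol_foldl u t b l : alsw (u ++ b) -> hol u t [::] b -> all alsw l ->
  {in l, forall c, lexgt (u ++ b ++ flatten l) c} ->
  hol u (foldl (fun t c => BNode t (std_tree c)) t l) [::] (b ++ flatten l).
Proof.
elim: l t b => [|c l IH] t b Hub Ht /=; first by rewrite cats0.
case/andP=> Hc Hl C.
have Hubc : alsw (u ++ b ++ c).
  rewrite catA; apply: alsw_cat => //.
  apply: lexge_gt_trans (C c (mem_head _ _)); rewrite catA; exact: lexge_prefix.
rewrite catA; apply: IH => //.
- by have := @hol_l u t (std_tree c) [::] b Ht (std_tree_std Hc); rewrite bword_std_tree //; apply.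
- by move=> c' c'l; rewrite -catA; apply: C; rewrite inE c'l orbT.
Qed.

Lemma hol_fact u c : alsw u -> alsw (u ++ c) ->
  hol u (foldl (fun t c' => BNode t (std_tree c')) BHole (fact c)) [::] c.
Proof.
move=> Hu Huc; case/and3P: (factP c) => /eqP E Hl S.
rewrite -{2}E -[flatten _]cat0s; apply: hol_foldl => //.
- by rewrite cats0.
- exact: hol_hole.
(* The last factor is the largest of the nondecreasing list, and as a proper suffix of the ALSW [uc]
   it is below [uc]. *)
rewrite cat0s E; case: (fact c) E Hl S => [|c1 l] // E Hl S x /(sorted_fact_last S) G.
apply: (lexgt_ge_trans _ G).
have Hlast : alsw (last c1 l) by apply: (allP Hl); exact: mem_last.
have E' : u ++ c = (u ++ flatten (belast c1 l)) ++ last c1 l.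
  by rewrite -E lastI -cats1 flatten_cat /= cats0 catA.
rewrite E'; apply: alsw_suffix_lt; rewrite -?E' //; last exact: alsw_neq0.
by move: (alsw_neq0 Hu); case: (u).
Qed.

(** If [u] begins strictly inside a node, it lies in one of the two halves. If it begins with the
    node and outgrows the left half, that node is the bracket [[uc]] to be replaced. *)
Lemma hol_splice u N t : alsw u ->
  (forall c, alsw (u ++ c) -> hol u (N c) [::] c) -> stdT t ->
  forall off a b, bword t = a ++ u ++ b ->
    hol u (splice (off + size a) (size u) N t off) a b.
Proof.
move=> Hu HN; have un := alsw_neq0 Hu.
elim=> [x|l r Hl IHl Hr IHr A L] off a b /= E.
  case: a E => [|y [|]] /=; [|by case: (u) un|by []].
  case: (u) un HN => [//|z [|//]] _ HN [-> <-].
  by rewrite addn0 eqxx /=; apply: HN.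
case: (eqVneq a [::]) => [a0|an].
  rewrite a0 /= addn0 eqxx; rewrite a0 /= in E; case: leqP => [lu|lu].
    case/esym/cat_eq_split: (E) => [[s [E1 E2]]|[s sn [E1 _]]]; last first.
      by move: lu; rewrite E1 size_cat; have := size_neq0 sn; lia.
    rewrite E2; apply: (@hol_l _ _ _ [::]) => //.
      by have := IHl off [::] s E1; rewrite addn0.
    by rewrite cat0s catA -E1.
  by rewrite E drop_size_cat //; apply: HN; rewrite -E.
rewrite -{1}[off]addn0 eqn_add2l eq_sym size_eq0 (negbTE an) ltn_add2l.
case/cat_eq_split: (E) => [[s [E1 E2]]|[s sn [E1 E2]]].
  rewrite E1 size_cat ltnNge leq_addr /= addnA.
  apply: hol_r => //; first exact: IHr.
  by rewrite -E2.
rewrite E1 size_cat -{1}[size a]addn0 ltn_add2l size_neq0 //.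
case/cat_eq_split: E2 => [[q [E2 E3]]|[q qn [E2 E3]]].
  rewrite E3; apply: hol_l => //; first by apply: IHl; rewrite E1 E2.
  by move: A; rewrite E1 E2 -!catA.
(* A straddling [u = sq] would overlap the right half in [q], so [s] followed by the right half
   would be a longer proper ALSW suffix. *)
by have := L _ _ an sn E1; rewrite E3 (alsw_overlap qn) // -?E2 // -E3; apply: stdT_alsw.
Qed.

Lemma hol_spec a u b : alsw u -> alsw (a ++ u ++ b) -> hol u (spec_tree true a u b) a b.
Proof.
move=> Hu H; have := @hol_splice u _ _ Hu _ (std_tree_std H) 0%N a b (bword_std_tree H).
by apply=> c; apply: hol_fact.
Qed.

End Words.

(** * The composition-diamond lemma in a free algebra *)

Section FreeAlgebra.
Context {dX : Order.disp_t} {X : orderType dX} {A : comNzRingType} {M : lalgType A}.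
Implicit Types (f g h s : M) (u v w a b p q r : seq X) (c : A) (t : @btree dX X).
Variables (wrd : seq X -> M) (cf : seq X -> M -> A).

Inductive low (P : seq X -> Prop) : M -> Prop :=
| low_wrd w : P w -> low P (wrd w)
| low0 : low P 0
| lowD f g : low P f -> low P g -> low P (f + g)
| lowZ c f : low P f -> low P (c *: f).

(** An abstract interface to the free associative algebra: words form a basis with coordinates [cf],
    and scalars are central. *)
Record free_alg : Prop := FreeAlg {
  wrdM : forall u v, wrd u * wrd v = wrd (u ++ v);
  wrd0 : wrd [::] = 1;
  scaleMr : forall c f g, f * (c *: g) = c *: (f * g);
  cfD : forall w f g, cf w (f + g) = cf w f + cf w g;
  cfZ : forall w c f, cf w (c *: f) = c * cf w f;
  cf_wrd : forall w v, cf w (wrd v) = (v == w)%:R;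
  low_all : forall f, low (fun _ => True) f }.

Hypothesis FA : free_alg.
Let wrdM' := wrdM FA.
Let scaleMr' := scaleMr FA.

Lemma cf0 w : cf w 0 = 0.
Proof. by have := cfZ FA w 0 0; rewrite scale0r mul0r. Qed.

Lemma lowN P f : low P f -> low P (- f).
Proof. by move=> ?; rewrite -scaleN1r; apply: lowZ. Qed.

Lemma lowB P f g : low P f -> low P g -> low P (f - g).
Proof. by move=> ? ?; apply: lowD => //; apply: lowN. Qed.

Lemma low_sub (P Q : seq X -> Prop) f : (forall w, P w -> Q w) -> low P f -> low Q f.
Proof. by move=> PQ; elim=> *; [apply/low_wrd/PQ|exact: low0|exact: lowD|exact: lowZ]. Qed.

Lemma low_coef P f w : low P f -> cf w f != 0 -> P w.
Proof.
elim=> [v Pv||g h _ IHg _ IHh|c g _ IH].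
- by rewrite (cf_wrd FA); case: (eqVneq v w) => [<-//|_]; rewrite eqxx.
- by rewrite cf0 eqxx.
- rewrite (cfD FA); case: (eqVneq (cf w g) 0) => [->|/IHg//].
  by rewrite add0r.
- by rewrite (cfZ FA); case: (eqVneq (cf w g) 0) => [->|/IH//]; rewrite mulr0 eqxx.
Qed.

Lemma low_coef0 P f w : low P f -> ~ P w -> cf w f = 0.
Proof. by move=> Hf nP; apply/eqP/negPn/negP => /(low_coef Hf). Qed.

Lemma lowM (P Q R : seq X -> Prop) f g : (forall u v, P u -> Q v -> R (u ++ v)) ->
  low P f -> low Q g -> low R (f * g).
Proof.
move=> PQR Hf Hg; elim: Hf => [u Pu||f1 f2 _ H1 _ H2|c f1 _ H1].
- elim: Hg => [v Qv||g1 g2 _ H1 _ H2|c g1 _ H1].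
  + by rewrite wrdM'; apply/low_wrd/PQR.
  + by rewrite mulr0; apply: low0.
  + by rewrite mulrDr; apply: lowD.
  + by rewrite scaleMr'; apply: lowZ.
- by rewrite mul0r; apply: low0.
- by rewrite mulrDl; apply: lowD.
- by rewrite -scalerAl; apply: lowZ.
Qed.

(** Monicity over [A]: the coefficient of the leading word is exactly 1. *)
Definition lead f w := low (dlgt w) (f - wrd w).

Lemma low_of_lead f w : lead f w -> low (dlge w) f.
Proof.
move=> H; rewrite -[f](subrK (wrd w)); apply: lowD.
  exact: low_sub (@dlgtW _ _ _) H.
exact/low_wrd/dlge_refl.
Qed.

Lemma lead_wrd w : lead (wrd w) w.
Proof. by rewrite /lead subrr; apply: low0. Qed.

Lemma dlge_gt_cat u u' v v' : dlge u u' -> dlgt v v' -> dlgt (u ++ v) (u' ++ v').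
Proof.
case/orP=> [/eqP<-|uu] vv; first exact: dlgt_catl.
exact: dlgt_trans (dlgt_catl u vv) (dlgt_catr v' uu).
Qed.

Lemma dlge_cat u u' v v' : dlge u u' -> dlge v v' -> dlge (u ++ v) (u' ++ v').
Proof.
move=> uu /orP[/eqP<-|vv]; last exact/dlgtW/dlge_gt_cat.
by case/orP: uu => [/eqP<-|/(dlgt_catr v)/dlgtW//]; apply: dlge_refl.
Qed.

Lemma leadM f g u v : lead f u -> lead g v -> lead (f * g) (u ++ v).
Proof.
move=> Hf Hg; rewrite /lead -wrdM'.
have -> : f * g - wrd u * wrd v = (f - wrd u) * g + wrd u * (g - wrd v).
  by rewrite mulrBl mulrBr addrA subrK.
apply: lowD.
  apply: lowM Hf (low_of_lead Hg) => u' v' uu /orP[/eqP<-|vv]; first exact: dlgt_catr.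
  exact: dlge_gt_cat (dlgtW uu) vv.
apply: lowM (low_of_lead (lead_wrd u)) Hg => u' v'; exact: dlge_gt_cat.
Qed.

Lemma lead_cf f w : lead f w -> cf w f = 1.
Proof.
move=> H; rewrite -[f](subrK (wrd w)) (cfD FA) (cf_wrd FA) eqxx.
by rewrite (low_coef0 H) ?add0r // dlgt_irr.
Qed.

Lemma alsw_rot_dlgt u v : alsw (u ++ v) -> u != [::] -> v != [::] ->
  dlgt (u ++ v) (v ++ u).
Proof.
by move=> H un vn; rewrite /dlgt !size_cat addnC ltnn eqxx /=; apply: alsw_rot.
Qed.

Definition comm f g := f * g - g * f.

Fixpoint teval s t : M :=
  match t with
  | BLeaf x => wrd [:: x]
  | BHole => s
  | BNode l r => comm (teval s l) (teval s r)
  end.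

(** As [uv] beats its rotation [vu], the product [gf] contributes only smaller words. *)
Lemma lead_comm f g u v : u != [::] -> v != [::] -> alsw (u ++ v) ->
  lead f u -> lead g v -> lead (comm f g) (u ++ v).
Proof.
move=> un vn H Hf Hg; rewrite /lead /comm addrAC; apply: lowB; first exact: leadM.
apply: low_sub (low_of_lead (leadM Hg Hf)) => w; apply: dlgt_ge_trans.
exact: alsw_rot_dlgt.
Qed.

Lemma lead_std s t : stdT t -> lead (teval s t) (bword t).
Proof.
elim=> [x|l r Hl IHl Hr IHr H _] /=; first exact: lead_wrd.
by apply: lead_comm => //; apply/alsw_neq0/stdT_alsw.
Qed.

(** * Associative s-words and reduction modulo an ideal *)

Section Ideal.
Variables (S : M -> Prop) (lw : M -> seq X).

(** For [P := dlgt w] this is associative triviality modulo [(S,w)], with coefficients in [A]. *)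
Inductive asp (P : seq X -> Prop) : M -> Prop :=
| asp_gen a s b : S s -> P (a ++ lw s ++ b) -> asp P (wrd a * s * wrd b)
| asp0 : asp P 0
| aspD f g : asp P f -> asp P g -> asp P (f + g)
| aspZ c f : asp P f -> asp P (c *: f).

Lemma aspN P f : asp P f -> asp P (- f).
Proof. by move=> ?; rewrite -scaleN1r; apply: aspZ. Qed.

Lemma aspB P f g : asp P f -> asp P g -> asp P (f - g).
Proof. by move=> ? ?; apply: aspD => //; apply: aspN. Qed.

Lemma asp_sub (P Q : seq X -> Prop) f : (forall w, P w -> Q w) -> asp P f -> asp Q f.
Proof. by move=> PQ; elim=> *; [apply/asp_gen/PQ|exact: asp0|exact: aspD|exact: aspZ]. Qed.

Lemma asp_mull (P Q R : seq X -> Prop) f g : (forall u v, Q u -> P v -> R (u ++ v)) ->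
  low Q f -> asp P g -> asp R (f * g).
Proof.
move=> QPR Hf Hg; elim: Hf => [u Qu||f1 f2 _ H1 _ H2|c f1 _ H1].
- elim: Hg => [a s b Ss Pw||g1 g2 _ H1 _ H2|c g1 _ H1].
  + by rewrite !mulrA wrdM'; apply: asp_gen => //; rewrite -catA; apply: QPR.
  + by rewrite mulr0; apply: asp0.
  + by rewrite mulrDr; apply: aspD.
  + by rewrite scaleMr'; apply: aspZ.
- by rewrite mul0r; apply: asp0.
- by rewrite mulrDl; apply: aspD.
- by rewrite -scalerAl; apply: aspZ.
Qed.

Lemma asp_mulr (P Q R : seq X -> Prop) f g : (forall u v, P u -> Q v -> R (u ++ v)) ->
  asp P f -> low Q g -> asp R (f * g).
Proof.
move=> PQR Hf Hg; elim: Hg => [u Qu||f1 f2 _ H1 _ H2|c f1 _ H1].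
- elim: Hf => [a s b Ss Pw||g1 g2 _ H1 _ H2|c g1 _ H1].
  + rewrite -!mulrA wrdM' mulrA; apply: asp_gen => //.
    by have := PQR _ _ Pw Qu; rewrite -!catA.
  + by rewrite mul0r; apply: asp0.
  + by rewrite mulrDl; apply: aspD.
  + by rewrite -scalerAl; apply: aspZ.
- by rewrite mulr0; apply: asp0.
- by rewrite mulrDr; apply: aspD.
- by rewrite scaleMr'; apply: aspZ.
Qed.

Hypothesis leadS : forall s, S s -> lead s (lw s).

Lemma asp_low P f : asp P f -> low (fun v => exists2 w, P w & dlge w v) f.
Proof.
elim=> [a s b Ss Pw||f1 f2 _ H1 _ H2|c f1 _ H1];
  [|exact: low0|exact: lowD|exact: lowZ].
have := leadM (leadM (lead_wrd a) (leadS Ss)) (lead_wrd b).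
move/low_of_lead; apply: low_sub => v; rewrite -catA.
by exists (a ++ lw s ++ b).
Qed.

(* A normal s-word differs from [a s b] by terms [a' s b'] with smaller
   leading words, because the word of each bracket beats its rotation. *)
Lemma hol_asp s t a b : S s -> alsw (lw s) -> hol (lw s) t a b ->
  asp (dlgt (a ++ lw s ++ b)) (teval s t - wrd a * s * wrd b).
Proof.
move=> Ss Hu; have un := alsw_neq0 Hu.
have W0 a' b' : a' ++ lw s ++ b' != [::].
  by case: a' => //=; case: (lw s) un.
elim=> {t a b} [|l r a b Hl IH Hr H|l r a b Hl Hr IH H] /=.
- by rewrite (wrd0 FA) mulr1 mul1r subrr; apply: asp0.
- set R := bword r; set m := wrd a * s * wrd b in IH.
  set W := a ++ lw s ++ b in IH; set L := teval s l in IH *; set rr := teval s r.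
  have LW : asp (dlge W) L.
    rewrite -[L](subrK m); apply: aspD; first exact: asp_sub (@dlgtW _ _ _) IH.
    by apply: asp_gen => //; apply: dlge_refl.
  have Lr : lead rr R := lead_std s Hr.
  (* With [m = a s b], the three summands are lower by the induction hypothesis, by the leading word
     [R] of [rr], and because [WR] beats its rotation [RW]. *)
  have -> : comm L rr - wrd a * s * wrd (b ++ R) =
            (L - m) * wrd R + L * (rr - wrd R) - rr * L.
    rewrite /comm -wrdM' mulrA -/m mulrBl mulrBr [_ - _ + (_ - _)]addrC addrA subrK.
    by rewrite addrAC.
  have -> : a ++ lw s ++ b ++ R = W ++ R by rewrite -!catA.
  apply: aspB; first apply: aspD.
  + by apply: asp_mulr IH (low_wrd (erefl R)) => u v uv <-; apply: dlgt_catr.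
  + by apply: asp_mulr LW Lr => u v; apply: dlge_gt_cat.
  + apply: asp_mull (low_of_lead Lr) LW => u v Ru Wv.
    apply: dlgt_ge_trans (dlge_cat Ru Wv); apply: alsw_rot_dlgt => //.
      by rewrite -!catA.
      exact: W0.
    exact: alsw_neq0 (stdT_alsw Hr).
- set R := bword l; set m := wrd a * s * wrd b in IH.
  set W := a ++ lw s ++ b in IH; set L := teval s r in IH *; set rr := teval s l.
  have LW : asp (dlge W) L.
    rewrite -[L](subrK m); apply: aspD; first exact: asp_sub (@dlgtW _ _ _) IH.
    by apply: asp_gen => //; apply: dlge_refl.
  have Lr : lead rr R := lead_std s Hl.
  have -> : comm rr L - wrd (R ++ a) * s * wrd b =
            wrd R * (L - m) + (rr - wrd R) * L - L * rr.
    rewrite /comm -wrdM' -!mulrA (mulrA (wrd a)) -/m.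
    rewrite mulrBl mulrBr [_ - _ + (_ - _)]addrC addrA subrK.
    by rewrite addrAC.
  rewrite -catA -/W; apply: aspB; first apply: aspD.
  + by apply: asp_mull (low_wrd (erefl R)) IH => u v <-; apply: dlgt_catl.
  + apply: asp_mull Lr LW => u v uR /orP[/eqP<-|]; first exact: dlgt_catr.
    exact/dlge_gt_cat/dlgtW.
  + apply: asp_mulr LW (low_of_lead Lr) => u v Wu Rv.
    apply: dlgt_ge_trans (dlge_cat Wu Rv); apply: alsw_rot_dlgt => //.
      exact: alsw_neq0 (stdT_alsw Hl).
    exact: W0.
Qed.

(* The inclusion and intersection compositions of associative
   Groebner-Shirshov bases. *)
Hypothesis compI : forall s1 s2 p q, S s1 -> S s2 -> lw s1 = p ++ lw s2 ++ q ->
  asp (dlgt (lw s1)) (s1 - wrd p * s2 * wrd q).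
Hypothesis compO : forall s1 s2 p q r, S s1 -> S s2 ->
  p != [::] -> q != [::] -> r != [::] -> lw s1 = p ++ q -> lw s2 = q ++ r ->
  asp (dlgt (p ++ q ++ r)) (s1 * wrd r - wrd p * s2).

(** Two leading words occurring in one word are disjoint, nested or properly overlapping. Disjoint
    ones need no composition; the other cases are [compI] and [compO] multiplied by words. *)
Lemma asp_same_word_le a1 s1 b1 a2 s2 b2 : S s1 -> S s2 ->
  a1 ++ lw s1 ++ b1 = a2 ++ lw s2 ++ b2 -> (size a1 <= size a2)%N ->
  asp (dlgt (a1 ++ lw s1 ++ b1)) (wrd a1 * s1 * wrd b1 - wrd a2 * s2 * wrd b2).
Proof.
move=> S1 S2 E le12; have [p Ep] : exists p, a2 = a1 ++ p.
  case: (cat_eq_split E) => [[p [-> _]]|[r rn [Er _]]]; first by exists p.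
  by move: le12; rewrite Er size_cat; have := size_neq0 rn; lia.
have E' : lw s1 ++ b1 = p ++ lw s2 ++ b2.
  by move/eqP: E; rewrite Ep -catA eqseq_cat // eqxx => /eqP.
rewrite Ep -wrdM' -!mulrA.
suff H : asp (dlgt (lw s1 ++ b1)) (s1 * wrd b1 - wrd p * (s2 * wrd b2)).
  rewrite -mulrBr; apply: (asp_mull _ (low_wrd (erefl a1)) H) => u v <-.
  exact: dlgt_catl.
case/cat_eq_split: E' => [[q [E1 E2]]|[q qn [E1 E2]]].
  rewrite E1 E2 -!wrdM'.
  (* Disjoint occurrences: both products are compared with [s1 q s2 b2]. *)
  have -> : s1 * (wrd q * (wrd (lw s2) * wrd b2)) - wrd (lw s1) * wrd q * (s2 * wrd b2)
     = (s1 - wrd (lw s1)) * (wrd q * s2 * wrd b2)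
       - s1 * wrd q * (s2 - wrd (lw s2)) * wrd b2.
    rewrite mulrBl !mulrBr !mulrBl !mulrA opprB.
    by rewrite [RHS]addrC addrA subrK.
  apply: aspB.
    apply: (asp_mull _ (leadS S1) (asp_gen S2 (erefl (q ++ lw s2 ++ b2)))) => u v uv <-.
    exact: dlgt_catr.
  have -> : s1 * wrd q * (s2 - wrd (lw s2)) * wrd b2
     = (wrd [::] * s1 * wrd q) * ((s2 - wrd (lw s2)) * wrd b2).
    by rewrite (wrd0 FA) mul1r !mulrA.
  apply: (asp_mulr _ (asp_gen S1 (erefl ([::] ++ lw s1 ++ q)))
           (lowM _ (leadS S2) (low_wrd (erefl b2)))).
    by move=> u v <- Rv; rewrite cat0s -catA; do 2!apply: dlgt_catl; apply: Rv.
  by move=> u v uv <- /=; apply: dlgt_catr.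
case/cat_eq_split: E2 => [[r [E2 E3]]|[r rn [E2 E3]]].
  rewrite E3 -wrdM' !mulrA -mulrBl.
  have H := compI S1 S2 (etrans E1 (congr1 (cat p) E2)).
  apply: (asp_mulr _ H (low_wrd (erefl b1))) => u v uv <-.
  exact: dlgt_catr.
rewrite E3 -wrdM' !mulrA -mulrBl.
suff H : asp (dlgt (lw s1 ++ r)) (s1 * wrd r - wrd p * s2).
  apply: (asp_mulr _ H (low_wrd (erefl b2))) => u v uv <-.
  by rewrite catA; apply: dlgt_catr.
(* With [p] empty, [lw s1] is a prefix of [lw s2]: an inclusion with the roles exchanged. *)
case: (eqVneq p [::]) => [p0|pn]; last by rewrite E1 -catA; apply: compO.
rewrite p0 /= in E1; rewrite p0 (wrd0 FA) mul1r -opprB E1 -E2.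
have E2' : lw s2 = [::] ++ lw s1 ++ r by rewrite E1.
by have := compI S2 S1 E2'; rewrite (wrd0 FA) mul1r => H; apply: aspN.
Qed.

Lemma asp_same_word a1 s1 b1 a2 s2 b2 : S s1 -> S s2 ->
  a1 ++ lw s1 ++ b1 = a2 ++ lw s2 ++ b2 ->
  asp (dlgt (a1 ++ lw s1 ++ b1)) (wrd a1 * s1 * wrd b1 - wrd a2 * s2 * wrd b2).
Proof.
move=> S1 S2 E; case: (leqP (size a1) (size a2)) => [|/ltnW] le12.
  exact: asp_same_word_le.
by rewrite -opprB E; apply/aspN/asp_same_word_le.
Qed.

(** By [asp_same_word], s-words with leading word [W] agree modulo lower ones, so all top terms
    merge into a multiple of a single [a s b]. *)
Lemma asp_top W f : asp (dlge W) f -> asp (dlgt W) f \/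
  exists c a s b, [/\ S s, a ++ lw s ++ b = W &
    asp (dlgt W) (f - c *: (wrd a * s * wrd b))].
Proof.
elim=> {f} [a s b Ss /orP[/eqP E|lt]||f g _ IHf _ IHg|c f _ IH].
- right; exists 1, a, s, b; rewrite scale1r subrr; split=> //; exact: asp0.
- by left; apply: asp_gen.
- by left; apply: asp0.
- case: IHf => [Hf|[c [a [s [b [Ss E Hf]]]]]];
    case: IHg => [Hg|[c' [a' [s' [b' [Ss' E' Hg]]]]]].
  + by left; apply: aspD.
  + by right; exists c', a', s', b'; split=> //; rewrite -addrA; apply: aspD.
  + by right; exists c, a, s, b; split=> //; rewrite addrAC; apply: aspD.
  + right; exists (c + c'), a, s, b; split=> //.
    set m := _ * wrd b; set m' := _ * wrd b' in Hg.
    have -> : f + g - (c + c') *: m = (f - c *: m) + (g - c' *: m') - c' *: (m - m').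
      by rewrite scalerBr opprB -(addrA (f - _)) (addrA (g - _)) subrK scalerDl opprD addrACA.
    apply: aspB; first exact: aspD.
    by rewrite -E; apply/aspZ/asp_same_word; rewrite // E E'.
- case: IH => [Hf|[c' [a [s [b [Ss E Hf]]]]]]; first by left; apply: aspZ.
  right; exists (c * c'), a, s, b; split=> //.
  by rewrite -scalerA -scalerBr; apply: aspZ.
Qed.

(** A finite combination has a largest leading word; this [V] is the bound to which well-founded
    induction descends. *)
Lemma asp_max W f : asp (dlgt W) f -> f = 0 \/ exists2 V, dlgt W V & asp (dlge V) f.
Proof.
elim=> [a s b Ss lt||f1 f2 _ IH1 _ IH2|c f1 _ IH].
- by right; exists (a ++ lw s ++ b) => //; apply: asp_gen => //; apply: dlge_refl.
- by left.
- case: IH1 => [->|[V1 W1 H1]]; first by rewrite add0r.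
  case: IH2 => [->|[V2 W2 H2]]; first by rewrite addr0; right; exists V1.
  right; case: (dlgt_total V1 V2) => [/dlgtW|] le12; [exists V1|exists V2] => //;
    by apply: aspD => //; first [apply: asp_sub H1|apply: asp_sub H2] => w; apply: dlge_trans.
- case: IH => [->|[V WV H]]; first by left; rewrite scaler0.
  by right; exists V => //; apply: aspZ.
Qed.

Variable I : A -> Prop.
Hypotheses (I0 : I 0) (ID : forall c c', I c -> I c' -> I (c + c'))
  (IM : forall c c', I c' -> I (c * c')).

(** The leading word of the image of [f] over the quotient of [A] by [I]. *)
Definition Ilead f W := ~ I (cf W f) /\ forall V, dlgt V W -> I (cf V f).

Lemma Ilead_uniq f V W : Ilead f V -> Ilead f W -> V = W.
Proof.
move=> [nV HV] [nW HW]; case: (dlgt_total V W) => [/HW//|/orP[/eqP//|/HV//]].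
Qed.

Lemma composition_diamond f g W : well_founded (fun v u : seq X => dlgt u v) ->
  asp (fun _ => True) f -> (forall V, I (cf V g)) -> Ilead (f + g) W ->
  exists a s b, S s /\ W = a ++ lw s ++ b.
Proof.
move=> wf; have IB c c' : I (c + c') -> I c' -> I c.
  by move=> Ic Ic'; rewrite -[c](addrK c'); apply: ID => //; rewrite -mulN1r; apply: IM.
have key V : forall f g : M, asp (dlge V) f -> (forall V, I (cf V g)) -> Ilead (f + g) W ->
    exists a s b, S s /\ W = a ++ lw s ++ b.
  elim: (wf V) => {f g}V _ IH f g Hf Hg HW.
  have low_case f' g' : asp (dlgt V) f' -> (forall V, I (cf V g')) -> Ilead (f' + g') W ->
      exists a s b, S s /\ W = a ++ lw s ++ b.
    case/asp_max=> [->|[V' VV' H]] Hg' HW'; last exact: (IH _ VV' _ _ H Hg' HW').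
    by case: HW'; rewrite add0r.
  case: (asp_top Hf) => [Hf'|[c [a [s [b [Ss E Hf']]]]]]; first exact: low_case Hf' Hg HW.
  set m := wrd a * s * wrd b in Hf'.
  have Lm : lead m V.
    by rewrite -E catA; apply: leadM (lead_wrd b); apply: leadM (lead_wrd a) (leadS Ss).
  have Ef : f + g = (f - c *: m) + (g + c *: m) by rewrite addrACA addNr addr0.
  (* A top coefficient in [I] is moved into [g], and the remaining combination is below [V]. *)
  case: (Classical_Prop.classic (I c)) => Ic.
    apply: (low_case _ (g + c *: m) Hf'); last by rewrite -Ef.
    by move=> U; rewrite (cfD FA) (cfZ FA) mulrC; apply: ID => //; apply: IM.
  (* Otherwise [f + g] has coefficient [c] modulo [I] at [V] and coefficients in [I] above it, so
     [V = W]. *)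
  exists a, s, b; split=> //; rewrite E; apply: (Ilead_uniq HW).
  have L0 U : dlge U V -> cf U (f - c *: m) = 0.
    move=> UV; apply: low_coef0 (asp_low Hf') _ => -[w Vw wU].
    by have := dlgt_ge_trans (dlge_gt_trans UV Vw) wU; rewrite dlgt_irr.
  split=> [|U VU]; rewrite Ef (cfD FA) L0 ?add0r ?(cfD FA) ?(cfZ FA) ?dlge_refl ?dlgtW //.
    by rewrite (lead_cf Lm) mulr1 addrC => /IB /(_ (Hg _)).
  rewrite (low_coef0 (low_of_lead Lm)) ?mulr0 ?addr0 // => UV.
  by have := dlgt_ge_trans VU UV; rewrite dlgt_irr.
move=> Hf Hg HW; suff [V HV] : exists V, asp (dlge V) f by apply: key HV Hg HW.
elim: Hf => [a s b Ss _||f1 f2 _ [V1 H1] _ [V2 H2]|c f1 _ [V H]].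
- by exists (a ++ lw s ++ b); apply: asp_gen => //; apply: dlge_refl.
- by exists [::]; apply: asp0.
- case: (dlgt_total V1 V2) => [/dlgtW|] le12; [exists V1|exists V2];
    by apply: aspD => //; first [apply: asp_sub H1|apply: asp_sub H2] => w; apply: dlge_trans.
- by exists V; apply: aspZ.
Qed.

Inductive gen_ideal : M -> Prop :=
| gi_rel s : S s -> gen_ideal s
| gi_coef c f : I c -> gen_ideal (c *: f)
| gi0 : gen_ideal 0
| giD f g : gen_ideal f -> gen_ideal g -> gen_ideal (f + g)
| giMl f g : gen_ideal g -> gen_ideal (f * g)
| giMr f g : gen_ideal f -> gen_ideal (f * g).

Lemma giZ c f : gen_ideal f -> gen_ideal (c *: f).
Proof. by move=> H; rewrite -[f]mul1r scalerAl; apply: giMl. Qed.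

Lemma giN f : gen_ideal f -> gen_ideal (- f).
Proof. by rewrite -scaleN1r; apply: giZ. Qed.

(** A generated form of having all coefficients in [I], for which stability under multiplication on
    either side is immediate. *)
Inductive icoef : M -> Prop :=
| icoef_gen c f : I c -> icoef (c *: f)
| icoef0 : icoef 0
| icoefD f g : icoef f -> icoef g -> icoef (f + g).

Lemma icoefP f : icoef f -> forall V, I (cf V f).
Proof.
elim=> [c g Ic V||g h _ Hg _ Hh V]; first by rewrite (cfZ FA) mulrC; apply: IM.
  by move=> V; rewrite cf0.
by rewrite (cfD FA); apply: ID.
Qed.

Lemma gen_ideal_split f : gen_ideal f ->
  exists f1 g, [/\ asp (fun _ => True) f1, forall V, I (cf V g) & f = f1 + g].
Proof.
suff: gen_ideal f -> exists f1 g,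
    [/\ asp (fun _ => True) f1, icoef g & f = f1 + g].
  by move=> H /H[f1 [g [H1 /icoefP H2 E]]]; exists f1, g.
elim=> {f} [s Ss|c f Ic||f g _ [f1 [f2 [Hf1 Hf2 ->]]] _ [g1 [g2 [Hg1 Hg2 ->]]]
           |f g _ [g1 [g2 [Hg1 Hg2 ->]]]|f g _ [f1 [f2 [Hf1 Hf2 ->]]]].
- exists s, 0; split; [|exact: icoef0|by rewrite addr0].
  by rewrite -[s]mulr1 -[s]mul1r -(wrd0 FA); apply: asp_gen.
- by exists 0, (c *: f); split; [exact: asp0|exact: icoef_gen|rewrite add0r].
- by exists 0, 0; split; [exact: asp0|exact: icoef0|rewrite addr0].
- by exists (f1 + g1), (f2 + g2); split; [exact: aspD|exact: icoefD|rewrite addrACA].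
- exists (f * g1), (f * g2); split; last by rewrite mulrDr.
    exact: asp_mull (low_all FA f) Hg1.
  elim: Hg2 => [c h Ic||h1 h2 _ H1 _ H2]; first by rewrite scaleMr'; apply: icoef_gen.
    by rewrite mulr0; apply: icoef0.
  by rewrite mulrDr; apply: icoefD.
- exists (f1 * g), (f2 * g); split; last by rewrite mulrDl.
    exact: asp_mulr Hf1 (low_all FA g).
  elim: Hf2 => [c h Ic||h1 h2 _ H1 _ H2]; first by rewrite -scalerAl; apply: icoef_gen.
    by rewrite mul0r; apply: icoef0.
  by rewrite mulrDl; apply: icoefD.
Qed.

Lemma gen_ideal_reducible f W : well_founded (fun v u : seq X => dlgt u v) ->
  gen_ideal f -> Ilead f W -> exists a s b, S s /\ W = a ++ lw s ++ b.
Proof.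
move=> wf /gen_ideal_split[f1 [g [H1 Hg ->]]]; exact: composition_diamond.
Qed.
End Ideal.
End FreeAlgebra.

(** * Leading words in the free algebra over polynomials *)

Lemma argmax_eq (T : eqType) (gt : rel T) x0 (s : seq T) z : z \in s ->
  (forall x, ~~ gt x x) -> (forall x, x \in s -> x != z -> gt z x && ~~ gt x z) ->
  argmax gt x0 s = z.
Proof.
move=> zs irr H; rewrite /argmax.
(* The fold is seeded with the head of [s], so for nonempty [s] the default [x0] never appears. *)
have: head x0 s \in s by case: s zs {H} => // x s _; apply: mem_head.
move: (head x0 s) => m ms.
suff F s' : {subset s' <= s} ->
    let r := foldr (fun x m => if gt x m then x else m) m s' in
    (r \in s) /\ (z \in s' -> r = z) by case: (F s) => // _ ->.
elim: s' => [|y s' IH] //= sub.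
have ys : y \in s by apply: sub; apply: mem_head.
have [|rs rz] := IH; first by move=> x xs; apply: sub; rewrite inE xs orbT.
set r := foldr _ _ _ in rs rz *; split; first by case: ifP.
rewrite inE => /predU1P[zy|/rz->]; last first.
  by case: (eqVneq y z) => [->|/(H _ ys)/andP[_ /negbTE->]//]; rewrite if_same.
rewrite -zy; case: (eqVneq r z) => [->|/(H _ rs)/andP[-> //]]; by rewrite if_same.
Qed.

Section Leading.
Context {k : fieldType} {dX dY : Order.disp_t} {X : orderType dX} {Y : orderType dY}.
Local Notation A := (@kY k dY Y).
Local Notation M := (@kYX k dX dY X Y).
Implicit Types (f g h s : M) (u v w a b p q r : seq X) (c : A) (t : @btree dX X).
Local Notation wrd := (@wrd k dX dY X Y).

Definition wcoef w f : A := f@_(FMonom w).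

Lemma kYX_wrdM u v : wrd u * wrd v = wrd (u ++ v).
Proof.
rewrite /Defs.wrd malgM_def fgmulUU mulr1; congr (<< _ *g _ >>).
by apply/eqP; rewrite fmP fmM.
Qed.

Lemma kYX_wrd0 : wrd [::] = 1.
Proof. by rewrite /Defs.wrd -fmoneE. Qed.

Lemma kYX_scaleMr c f g : f * (c *: g) = c *: (f * g).
Proof.
pose C : M := @mkmalgU {fmonom X} A (fmone X) c.
have Z (h : M) : c *: h = C * h by rewrite -(@mul_malgC {fmonom X} A).
have E : f * C = C * f.
  rewrite [f](@monalgE {fmonom X} A) mulr_suml mulr_sumr; apply: eq_bigr => m _.
  by rewrite !malgM_def !fgmulUU mulrC mul1m mulm1.
rewrite [c *: g]Z [c *: (f * g)]Z mulrA E -mulrA; exact: erefl.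
Qed.

Lemma kYX_low_all f : low wrd (fun _ => True) f.
Proof.
rewrite [f](@monalgE {fmonom X} A); elim/big_rec: _ => [|[m] g _ H]; first exact: low0.
apply: lowD H; suff -> : << f@_(FMonom m) *g FMonom m >> = f@_(FMonom m) *: wrd m.
  exact/lowZ/low_wrd.
by apply/malgP=> w; rewrite mcoeffZ !mcoeffU mulrnAr mulr1.
Qed.

Lemma kYX_free : free_alg wrd wcoef.
Proof.
split.
- exact: kYX_wrdM.
- exact: kYX_wrd0.
- exact: kYX_scaleMr.
- by move=> w f g; rewrite /wcoef mcoeffD.
- by move=> w c f; rewrite /wcoef mcoeffZ.
- by move=> w v; rewrite /wcoef mcoeffU fmP.
- exact: kYX_low_all.
Qed.
Local Notation FA := kYX_free.

Lemma beval_teval s t : beval s t = teval wrd s t.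
Proof. by elim: t => //= l -> r ->. Qed.

Lemma lead_bracket w : alsw w -> lead wrd (bracket w) w.
Proof.
move=> Hw; have := lead_std FA 0 (std_tree_std Hw).
by rewrite (bword_std_tree Hw) /bracket beval_teval.
Qed.

Lemma lead_lwX f w : lead wrd f w -> lwX f = w.
Proof.
move=> H; suff E : argmax (fun a b : {fmonom X} => dlgt (fmonom_val a) (fmonom_val b))
  (FMonom [::]) (msupp f) = FMonom w by rewrite /lwX E.
apply: argmax_eq => [|x|[x] xs xw].
- by rewrite -mcoeff_neq0 -/(wcoef w f) (lead_cf FA H) oner_eq0.
- by rewrite dlgt_irr.
have : dlge w x by apply: (low_coef FA (low_of_lead H)); rewrite /wcoef mcoeff_neq0.
rewrite /dlge; case: eqP => [E|_ /= wx]; first by rewrite E eqxx in xw.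
by rewrite wx; apply/negP => /(dlgt_trans wx); rewrite dlgt_irr.
Qed.

Lemma lead_lwY f w : lead wrd f w -> lwY f = onecm Y.
Proof.
move=> H; rewrite /lwY (lead_lwX H).
have -> : f@_(FMonom w) = 1 := lead_cf FA H.
have -> : msupp (1 : A) = [fset onecm Y]%fset by rewrite msuppC oner_eq0.
apply: argmax_eq => [|x|x].
- by rewrite inE.
- by rewrite /dlgtY dlgt_irr.
- by rewrite inE => ->.
Qed.

(** Each [[u_i]] has leading word [u_i], and the [u_i] decrease, so the first bracket, with
    coefficient 1, dominates. *)
Lemma kYmonic_lead f : kYmonic f -> alsw (lwX f) /\ lead wrd f (lwX f).
Proof.
case=> u [l [E Hu Hl S]]; suff L : lead wrd f u by rewrite (lead_lwX L).
rewrite /lead E addrAC.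
apply: lowD; first exact: lead_bracket.
have L : all (fun e : A * seq X => dlgt u e.2) l.
  apply: (@order_path_min _ (fun e e' : A * seq X => dlgt e.2 e'.2) (1, u) l _ S).
  by move=> x y z; apply: dlgt_trans.
elim: l Hl L {S E} => [|p l IH]; first by rewrite big_nil => _ _; apply: low0.
move=> /= /andP[/andP[Hp _] Hl] /andP[Lp Ll]; rewrite big_cons.
apply: lowD; last exact: IH.
apply/lowZ/(low_sub _ (low_of_lead (lead_bracket Hp))) => w.
exact: dlgt_ge_trans.
Qed.

Section Basis.
Variable S : M -> Prop.
Hypotheses (SG : GSB S) (SM : forall s, S s -> kYmonic s).

Lemma leadS s : S s -> lead wrd s (lwX s).
Proof. by move/SM/kYmonic_lead => []. Qed.

Lemma alswS s : S s -> alsw (lwX s).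
Proof. by move/SM/kYmonic_lead => []. Qed.

Lemma lwYS s : S s -> lwY s = onecm Y.
Proof. by move/leadS/lead_lwY. Qed.

Lemma nsw_asp s a b : S s -> alsw (a ++ lwX s ++ b) ->
  asp wrd S lwX (dlgt (a ++ lwX s ++ b)) (nsw s a b - wrd a * s * wrd b).
Proof.
move=> Ss H; rewrite /nsw beval_teval.
apply: (hol_asp FA) => //; first exact: alswS.
by apply: hol_spec => //; apply: alswS.
Qed.

(** Hence a bound [(1,w)] in [mgt] forces the word in [X] itself to be smaller than [w]. *)
Lemma dlgtY1 (m : {cmonom Y}) : dlgtY (onecm Y) m = false.
Proof.
suff E : cm_seq (onecm Y) = [::] by rewrite /dlgtY /dlgt E /=; case: (cm_seq m).
rewrite /cm_seq mdom1; have -> // : enum_fset (fset0 : {fset Y}) = [::].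
exact/size0nil/(cardfs0 Y).
Qed.

(** Lie triviality implies associative triviality: each normal s-word expands into [a s b] and lower
    s-words. *)
Lemma trivial_asp h w : trivial_mod S h (onecm Y, w) -> asp wrd S lwX (dlgt w) h.
Proof.
case=> l [Hl ->]; elim: l Hl => [|t l IH] Hl; first by rewrite big_nil; apply: asp0.
rewrite big_cons; apply: aspD; last by apply: IH => x xl; apply: Hl; right.
case: (Hl t (or_introl erefl)) => St At.
rewrite /mgt /= dlgtY1 andbF orbF => wt; apply: aspZ.
rewrite -[nsw _ _ _](subrK (wrd (st_a t) * st_s t * wrd (st_b t))).
apply: aspD; last exact: asp_gen.
by apply: asp_sub (nsw_asp St At) => v; apply: dlgt_trans.
Qed.

Lemma lcm1 : lcmcm (onecm Y) (onecm Y) = onecm Y.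
Proof.
by apply/eqP/cmP => y; rewrite /lcmcm cmE /= fsfunE onecmE if_same.
Qed.

Lemma div1 : ymon (divcm (onecm Y) (onecm Y)) = 1 :> A.
Proof.
rewrite /ymon; have -> // : divcm (onecm Y) (onecm Y) = onecm Y.
by apply/eqP/cmP => y; rewrite divcmE onecmE.
Qed.

Lemma incl_asp s1 s2 p q : S s1 -> S s2 -> lwX s1 = p ++ lwX s2 ++ q ->
  asp wrd S lwX (dlgt (lwX s1)) (s1 - wrd p * s2 * wrd q).
Proof.
move=> S1 S2 E; have [_ [/(_ _ _ S1 S2)[C _ _] _]] := SG.
have := C _ _ E; rewrite /C1 !lwYS // lcm1 div1 !scale1r => /trivial_asp H.
have -> : s1 - wrd p * s2 * wrd q = (s1 - nsw s2 p q) + (nsw s2 p q - wrd p * s2 * wrd q).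
  by rewrite addrA subrK.
apply: aspD; first exact: H.
by rewrite E; apply: nsw_asp => //; rewrite -E; apply: alswS.
Qed.

(** The Lie and the associative composition differ by two corrections from [nsw_asp], both below
    [pqr], which is an ALSW as a union of overlapping ALSWs. *)
Lemma overlap_asp s1 s2 p q r : S s1 -> S s2 ->
  p != [::] -> q != [::] -> r != [::] -> lwX s1 = p ++ q -> lwX s2 = q ++ r ->
  asp wrd S lwX (dlgt (p ++ q ++ r)) (s1 * wrd r - wrd p * s2).
Proof.
move=> S1 S2 pn qn rn E1 E2; have [_ [/(_ _ _ S1 S2)[_ C _] _]] := SG.
have := C _ _ _ pn qn rn E1 E2; rewrite /C2 !lwYS // lcm1 div1 !scale1r => /trivial_asp H.
have Hw : alsw (p ++ q ++ r) by apply: alsw_overlap; rewrite -?E1 -?E2 //; apply: alswS.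
have W1 : [::] ++ lwX s1 ++ r = p ++ q ++ r by rewrite E1 -catA.
have W2 : p ++ lwX s2 ++ [::] = p ++ q ++ r by rewrite E2 cats0.
have H1 : asp wrd S lwX (dlgt (p ++ q ++ r)) (nsw s1 [::] r - s1 * wrd r).
  by have := @nsw_asp s1 [::] r S1; rewrite W1 kYX_wrd0 mul1r; apply.
have H2 : asp wrd S lwX (dlgt (p ++ q ++ r)) (nsw s2 p [::] - wrd p * s2).
  by have := @nsw_asp s2 p [::] S2; rewrite W2 kYX_wrd0 mulr1; apply.
have -> : s1 * wrd r - wrd p * s2 = (nsw s1 [::] r - nsw s2 p [::])
    - (nsw s1 [::] r - s1 * wrd r) + (nsw s2 p [::] - wrd p * s2).
  move: (nsw s1 _ _) (nsw s2 _ _) => n1 n2.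
  by rewrite opprB [n1 - n2 + _]addrC !addrA !subrK.
apply: aspD H2; apply: aspB H1; rewrite E1 -catA in H; exact: H.
Qed.

End Basis.
End Leading.

(** * Standard brackets span Lie expressions *)

Section LieExpressions.
Context {k : fieldType} {dX dY : Order.disp_t} {X : orderType dX} {Y : orderType dY}.
Local Notation A := (@kY k dY Y).
Local Notation M := (@kYX k dX dY X Y).
Local Notation lexp := (@lexp k dX dY X Y).
Implicit Types (s : M) (u v w : seq X) (c : A) (e : lexp) (t : @btree dX X).

Section Span.
Variables (R : A -> Prop) (S : M -> Prop).
Local Notation LEq := (LEq R S).

#[local] Instance LEq_equiv : Equivalence LEq.
Proof. by split=> [e|e1 e2|e1 e2 e3]; [exact: LEq_refl|exact: LEq_sym|exact: LEq_trans]. Qed.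

#[local] Instance LAdd_proper : Proper (LEq ==> LEq ==> LEq) LAdd.
Proof. by move=> e1 e1' H1 e2 e2' H2; apply: LEq_add. Qed.

#[local] Instance LScale_proper c : Proper (LEq ==> LEq) (LScale c).
Proof. by move=> e e' H; apply: LEq_scale. Qed.

#[local] Instance LBr_proper : Proper (LEq ==> LEq ==> LEq) LBr.
Proof. by move=> e1 e1' H1 e2 e2' H2; apply: LEq_br. Qed.

#[local] Hint Resolve LEq_refl : core.

Lemma LEq_addr0 e : LEq (LAdd e LZero) e.
Proof. by rewrite LEq_addC LEq_add0. Qed.

Lemma LEq_cancel e1 e2 : LEq (LAdd e1 e2) LZero -> LEq e1 (LScale (-1) e2).
Proof.
move=> H; apply: LEq_trans (LEq_sym (LEq_addr0 e1)) _.
by rewrite -(LEq_addN R S e2) LEq_addA H LEq_add0.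
Qed.

Lemma LEq_addACA e1 e2 e3 e4 :
  LEq (LAdd (LAdd e1 e2) (LAdd e3 e4)) (LAdd (LAdd e1 e3) (LAdd e2 e4)).
Proof.
rewrite -!LEq_addA; apply: LEq_add => //.
by rewrite LEq_addA (LEq_addC _ _ e2 e3) -LEq_addA.
Qed.

Lemma LEq_scale0r e : LEq (LScale 0 e) LZero.
Proof.
have -> : 0 = 1 + -1 :> A by rewrite subrr.
by rewrite LEq_scaleDl LEq_scale1 LEq_addN.
Qed.

Lemma LEq_scaler0 c : LEq (LScale c LZero) LZero.
Proof. by rewrite -(LEq_scale0r LZero) -LEq_scaleA mulr0. Qed.

Lemma LEq_br0l e : LEq (LBr LZero e) LZero.
Proof. by rewrite -{1}(LEq_scale0r LZero) LEq_brZl LEq_scale0r. Qed.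

Lemma LEq_br0r e : LEq (LBr e LZero) LZero.
Proof. by rewrite -{1}(LEq_scale0r LZero) LEq_brZr LEq_scale0r. Qed.

Lemma LEq_antisym e1 e2 : LEq (LBr e1 e2) (LScale (-1) (LBr e2 e1)).
Proof.
apply: LEq_cancel; have := LEq_alt R S (LAdd e1 e2).
by rewrite LEq_brDl !LEq_brDr !LEq_alt LEq_add0 LEq_addr0.
Qed.

Lemma LEq_leibniz e1 e2 e3 :
  LEq (LBr (LBr e1 e2) e3) (LAdd (LBr (LBr e1 e3) e2) (LBr e1 (LBr e2 e3))).
Proof.
have := LEq_jacobi R S e1 e2 e3; rewrite -LEq_addA => /LEq_cancel ->.
rewrite LEq_addC LEq_scaleDr; apply: LEq_add.
  by rewrite (LEq_antisym e3 e1) LEq_brZl -LEq_scaleA mulrNN mulr1 LEq_scale1.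
by rewrite -LEq_antisym.
Qed.

(** Bracketings are lifted to formal expressions, since equality in [Lie_K(X|S)] is a relation on
    those. *)
Fixpoint tlex e t : lexp :=
  match t with
  | BLeaf x => LGen x
  | BHole => e
  | BNode l r => LBr (tlex e l) (tlex e r)
  end.

Lemma leval_tlex e t : leval (tlex e t) = beval (leval e) t.
Proof.
elim: t => [x||l IHl r IHr] /=; [exact: erefl|exact: erefl|].
rewrite IHl IHr; exact: erefl.
Qed.

Definition lstd w := tlex LZero (std_tree w).

Lemma leval_lstd w : leval (lstd w) = bracket w.
Proof. exact: leval_tlex. Qed.

Lemma lstd_cat u v : alsw u -> alsw v -> alsw (u ++ v) -> longest_suffix u v ->
  lstd (u ++ v) = LBr (lstd u) (lstd v).
Proof.
move=> Hu Hv Huv L.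
suff E : std_tree (u ++ v) = BNode (std_tree u) (std_tree v) by rewrite /lstd E.
apply: stdT_inj; first exact: std_tree_std.
  by apply: stdT_node; rewrite ?bword_std_tree //; apply: std_tree_std.
by rewrite /= !bword_std_tree.
Qed.

Lemma tlex_hol e t u a b : hol u t a b -> LEq e LZero -> LEq (tlex e t) LZero.
Proof.
move=> H E; elim: H => [|l r a' b' _ IH _ _|l r a' b' _ _ IH _] //=.
  by rewrite IH LEq_br0l.
by rewrite IH LEq_br0r.
Qed.

(** Closing the span under [LEq] makes it a notion in the presented Lie algebra; with no relations
    this is the free [k[Y]]-Lie algebra. *)
Inductive LSp (P : seq X -> Prop) : lexp -> Prop :=
| LSp_std v : alsw v -> P v -> LSp P (lstd v)
| LSp_0 : LSp P LZero
| LSpD e1 e2 : LSp P e1 -> LSp P e2 -> LSp P (LAdd e1 e2)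
| LSpZ c e : LSp P e -> LSp P (LScale c e)
| LSp_eq e1 e2 : LEq e1 e2 -> LSp P e2 -> LSp P e1.

Lemma LSp_sub (P Q : seq X -> Prop) e : (forall w, alsw w -> P w -> Q w) ->
  LSp P e -> LSp Q e.
Proof.
move=> PQ; elim=> [v Hv Pv||e1 e2 _ H1 _ H2|c e1 _ H|e1 e2 E _ H].
- by apply: LSp_std (PQ _ _ _).
- exact: LSp_0.
- exact: LSpD.
- exact: LSpZ.
- exact: LSp_eq E H.
Qed.

Lemma LSp_br (P Q : seq X -> Prop) e e' :
  (forall w, alsw w -> P w -> LSp Q (LBr e (lstd w))) -> LSp P e' -> LSp Q (LBr e e').
Proof.
move=> H; elim=> [v Hv Pv||e1 e2 _ H1 _ H2|c e1 _ H1|e1 e2 E _ H1].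
- exact: H.
- by apply: LSp_eq (LEq_br0r _) _; exact: LSp_0.
- by apply: LSp_eq (LEq_brDr _ _ _ _ _) _; exact: LSpD.
- by apply: LSp_eq (LEq_brZr _ _ _ _ _) _; exact: LSpZ.
- by apply: LSp_eq (LEq_br (LEq_refl _ _ _) E) H1.
Qed.

Lemma LSp_brC P e e' : LSp P (LBr e e') -> LSp P (LBr e' e).
Proof. by move=> H; apply: LSp_eq (LEq_antisym _ _) _; apply: LSpZ. Qed.

(* Rewriting [[u1 u2] v] = [[u1 v] u2] + [u1 [u2 v]] moves the concatenated
   words down in the deg-lex order, or keeps [uv] and shortens [u]. *)
Lemma LSp_br_lt u v : well_founded (fun v u : seq X => dlgt u v) ->
  alsw u -> alsw v -> lexgt u v ->
  LSp (fun w => size w = size (u ++ v) /\ lexge (u ++ v) w) (LBr (lstd u) (lstd v)).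
Proof.
move=> wf; move E: (u ++ v) => W; elim: (wf W) u v E => {}W _ IHW.
suff step n : forall u v, u ++ v = W -> (size u < n)%N -> alsw u -> alsw v -> lexgt u v ->
    LSp (fun w => size w = size W /\ lexge W w) (LBr (lstd u) (lstd v)).
  (* The outer induction is on the word [W], the inner one on the length of the left factor with [W]
     fixed. *)
  by move=> u v E; apply: (step (size u).+1 u v E).
elim: n => [//|n IHn] u v E sn Hu Hv uv.
have Huv := alsw_cat Hu Hv uv.
have std : longest_suffix u v -> LSp (fun w => size w = size W /\ lexge W w) (LBr (lstd u) (lstd v)).
  move=> L; rewrite -lstd_cat //; apply: LSp_std => //.
  by rewrite E lexge_refl.
case: (leqP (size u) 1) => [u1|u1].
  apply: std; case: (u) u1 Hu => [|x [|//]] // _ _.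
  exact: longest_suffix1.
case: (std_splitP Hu u1) => u1' u2 Eu un Hu1 Hu2 L.
have u2n := alsw_neq0 Hu2; have vn := alsw_neq0 Hv.
case: (boolP (lexgt u2 v)) => [u2v|]; last first.
  (* For [v >= u2] the factorization of [uv] into [u] and [v] is already standard. *)
  by rewrite lexgtN => vu2; apply: std; rewrite Eu; apply: longest_suffix_cat.
have s1 := size_neq0 un; have s2 := size_neq0 u2n; have s3 := size_neq0 vn.
have EW : W = u1' ++ u2 ++ v by rewrite -E Eu -catA.
have sW : size W = (size u1' + size u2 + size v)%N by rewrite EW !size_cat addnA.
have u12 : lexgt (u1' ++ u2) u2 by apply: alsw_suffix_lt; rewrite -?Eu.
have W2 q : lexgt W (u2 ++ q).
  by rewrite EW catA; apply: lexgt_cat => //; rewrite size_cat leq_addl.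
have u1u : lexge u1' u by rewrite Eu; apply: lexge_prefix.
have down p q : alsw p -> alsw q -> lexgt p q -> size (p ++ q) = size W -> lexgt W (p ++ q) ->
    LSp (fun w => size w = size W /\ lexge W w) (LBr (lstd p) (lstd q)).
  move=> Hp Hq pq spq Wpq; apply: LSp_sub (IHW (p ++ q) _ p q erefl Hp Hq pq).
    move=> w _ [sw gw]; rewrite sw; split=> //.
    exact: lexgtW (lexgt_ge_trans Wpq gw).
  by rewrite /dlgt spq ltnn eqxx.
rewrite Eu lstd_cat //; last by rewrite -Eu.
apply: LSp_eq (LEq_leibniz _ _ _) _; apply: LSpD.
- apply: LSp_brC; apply: (LSp_br _ (IHW (u1' ++ v) _ u1' v erefl Hu1 Hv _)).
  + move=> w Hw [sw gw]; apply: LSp_brC.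
    have sw2 : size (w ++ u2) = size W by rewrite size_cat sw size_cat sW; clear; lia.
    have [wu|[wu|uw]] : lexgt w u2 \/ w = u2 \/ lexgt u2 w.
      by case/or3P: (lexgt_total w u2) => [/eqP|H|H]; [right; left|left|right; right].
    (* [w u2 <= u1' v u2 < u1' u2 v = W], since the ALSW [u2 v] beats its rotation. *)
    * apply: down => //; apply: (lexgt_ge_trans (v := u1' ++ v ++ u2)).
        by rewrite EW lexgt_cat2l; apply: alsw_rot => //; apply: alsw_cat.
      rewrite catA; case/orP: gw => [/eqP->|gw]; first exact: lexge_refl.
      by apply/lexgtW/lexgt_cat; rewrite // sw.
    * by rewrite wu; apply: LSp_eq (LEq_alt _ _ _) _; apply: LSp_0.
    * by apply: LSp_brC; apply: down; rewrite // size_cat addnC -size_cat.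
  + by rewrite /dlgt sW size_cat; apply/orP; left; clear -s1 s2 s3; lia.
  + exact: lexge_gt_trans u1u uv.
- apply: (LSp_br _ (IHW (u2 ++ v) _ u2 v erefl Hu2 Hv u2v)); last first.
    by rewrite /dlgt sW size_cat; apply/orP; left; clear -s1 s2 s3; lia.
  move=> w Hw [sw gw].
  have u1w : lexgt u1' w.
    apply: lexgt_ge_trans gw; apply: (lexge_gt_trans (v := W)).
      by rewrite EW; apply: lexge_prefix.
    exact: W2.
  have su1 : size (u1' ++ w) = size W by rewrite size_cat sw size_cat sW; clear; lia.
  have : lexge W (u1' ++ w) by rewrite EW lexge_cat2l.
  (* Either [u1' w] is strictly below [W], or it equals [W] and the left factor [u1'] is shorter
     than [u]. *)
  case/orP=> [/eqP E'|W1]; last exact: down.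
  apply: (IHn _ _ (esym E') _ Hu1 Hw u1w).
  by move: sn s2; rewrite Eu size_cat; clear; lia.
Qed.

Lemma LSp_all (wfX : well_ordered X) e : LSp (fun _ => True) e.
Proof.
have wf := dlgt_wf wfX.
elim: e => [x||e1 H1 e2 H2|c e H|e1 H1 e2 H2].
- exact: (@LSp_std _ [:: x]).
- exact: LSp_0.
- exact: LSpD.
- exact: LSpZ.
apply: (LSp_br _ H2) => v Hv _; apply: LSp_brC; apply: (LSp_br _ H1) => u Hu _.
case/or3P: (lexgt_total u v) => [/eqP->|uv|vu].
- by apply: LSp_eq (LEq_alt _ _ _) _; apply: LSp_0.
- by apply: LSp_brC; apply: LSp_sub (LSp_br_lt wf Hu Hv uv).
- by apply: LSp_sub (LSp_br_lt wf Hv Hu vu).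
Qed.

Lemma LSp_top V e : LSp (dlge V) e -> LSp (dlgt V) e \/
  (alsw V /\ exists c e', LSp (dlgt V) e' /\ LEq e (LAdd (LScale c (lstd V)) e')).
Proof.
elim=> {e} [v Hv /orP[/eqP->|lt]||e1 e2 _ IH1 _ IH2|c e _ IH|e1 e2 E _ IH].
- right; split=> //; exists 1, LZero; split; first exact: LSp_0.
  by rewrite LEq_addr0 LEq_scale1.
- by left; apply: LSp_std.
- by left; apply: LSp_0.
- case: IH1 => [H1|[HV [c1 [e1' [H1 E1]]]]];
    case: IH2 => [H2|[HV' [c2 [e2' [H2 E2]]]]].
  + by left; apply: LSpD.
  + right; split=> //; exists c2, (LAdd e1 e2'); split; first exact: LSpD.
    by rewrite E2 !LEq_addA (LEq_addC _ _ e1).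
  + right; split=> //; exists c1, (LAdd e1' e2); split; first exact: LSpD.
    by rewrite E1 !LEq_addA.
  + right; split=> //; exists (c1 + c2), (LAdd e1' e2'); split; first exact: LSpD.
    by rewrite E1 E2 LEq_scaleDl LEq_addACA.
- case: IH => [H|[HV [c' [e' [H E]]]]]; first by left; apply: LSpZ.
  right; split=> //; exists (c * c'), (LScale c e'); split; first exact: LSpZ.
  by rewrite E LEq_scaleDr LEq_scaleA.
- case: IH => [H|[HV [c' [e' [H E']]]]]; first by left; apply: LSp_eq E H.
  by right; split=> //; exists c', e'; split=> //; apply: LEq_trans E E'.
Qed.

Lemma LSp_max P e : LSp P e -> LEq e LZero \/ exists2 V, P V & LSp (dlge V) e.
Proof.
elim=> {e} [v Hv Pv||e1 e2 _ IH1 _ IH2|c e _ IH|e1 e2 E _ IH].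
- by right; exists v => //; apply: LSp_std => //; apply: dlge_refl.
- by left.
- case: IH1 => [E1|[V1 P1 H1]].
    case: IH2 => [E2|[V2 P2 H2]]; first by left; rewrite E1 E2 LEq_add0.
    by right; exists V2 => //; apply: LSp_eq H2; rewrite E1 LEq_add0.
  case: IH2 => [E2|[V2 P2 H2]].
    by right; exists V1 => //; apply: LSp_eq H1; rewrite E2 LEq_addr0.
  right; case: (dlgt_total V1 V2) => [/dlgtW|] le12; [exists V1|exists V2] => //;
    by apply: LSpD => //; first [apply: LSp_sub H1|apply: LSp_sub H2] => w _; apply: dlge_trans.
- case: IH => [E|[V PV H]]; first by left; rewrite E LEq_scaler0.
  by right; exists V => //; apply: LSpZ.
- case: IH => [E'|[V PV H]]; first by left; rewrite E E'.
  by right; exists V => //; apply: LSp_eq E H.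
Qed.

End Span.
End LieExpressions.

(** * Lie and associative presentations *)

Lemma jacobi_sum (V : zmodType) (x1 x2 x3 x4 x5 x6 : V) :
  (x1 - x2 - (x3 - x4)) + (x5 - x4 - (x1 - x6)) + (x3 - x6 - (x5 - x2)) = 0.
Proof.
rewrite !opprB !addrA.
(* The permutation puts each of the twelve terms next to its negative. *)
rewrite [LHS](ACl (1*8*2*11*3*6*4*9*5*12*7*10))/=.
by rewrite subrr sub0r addNr add0r subrr sub0r addNr add0r subrr add0r subrr.
Qed.

Lemma commutator_jacobi (V : nzRingType) (a b c : V) :
  ((a * b - b * a) * c - c * (a * b - b * a))
  + ((b * c - c * b) * a - a * (b * c - c * b))
  + ((c * a - a * c) * b - b * (c * a - a * c)) = 0.
Proof. by rewrite !mulrBl !mulrBr !mulrA jacobi_sum. Qed.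

Section Soundness.
Context {k : fieldType} {dX dY : Order.disp_t} {X : orderType dX} {Y : orderType dY}.
Local Notation A := (@kY k dY Y).
Local Notation M := (@kYX k dX dY X Y).
Local Notation lexp := (@lexp k dX dY X Y).
Local Notation aexp := (@aexp k dX dY X Y).
Local Notation wrd := (@wrd k dX dY X Y).
Implicit Types (f g h s : M) (u v w : seq X) (c : A) (e : lexp) (t : @btree dX X).

Lemma inId0 (R : A -> Prop) : inId R 0.
Proof. by exists [::]; split=> //; rewrite big_nil. Qed.

Lemma inIdD (R : A -> Prop) c c' : inId R c -> inId R c' -> inId R (c + c').
Proof.
move=> [l [Hl ->]] [l' [Hl' ->]]; exists (l ++ l'); split; last by rewrite big_cat.
by move=> p /(@List.in_app_or _ l l')[/Hl|/Hl'].
Qed.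

Lemma inIdM (R : A -> Prop) c c' : inId R c' -> inId R (c * c').
Proof.
move=> [l [Hl ->]]; exists [seq (c * p.1, p.2) | p <- l]; split.
  by move=> p /(@List.in_map_iff _ _ _ l)[q [<- /Hl]].
rewrite big_map mulr_sumr; apply: eq_bigr => p _; exact: mulrA.
Qed.

Fixpoint aeval (a : aexp) : M :=
  match a with
  | AGen x => wrd [:: x]
  | AZero => 0
  | AOne => 1
  | AAdd a1 a2 => aeval a1 + aeval a2
  | AScale c a1 => c *: aeval a1
  | AMul a1 a2 => aeval a1 * aeval a2
  end.

Lemma aeval_ltoa e : aeval (ltoa e) = leval e.
Proof.
elim: e => [x||e1 H1 e2 H2|c e H|e1 H1 e2 H2] /=; rewrite ?H1 ?H2 ?H ?scaleN1r; exact: erefl.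
Qed.

Section Relations.
Variables (R : A -> Prop) (S : M -> Prop).
Local Notation J := (gen_ideal S (inId R)).

Lemma giE f g : f = g -> J (f - g).
Proof. by move=> ->; rewrite subrr; apply: gi0. Qed.

Lemma giB f g : J f -> J g -> J (f - g).
Proof. by move=> Hf Hg; apply: giD => //; apply: giN. Qed.

Lemma giC f g : J (f - g) -> J (g - f).
Proof. by move=> H; rewrite -opprB; apply: giN. Qed.

Lemma gi_trans f g h : J (f - g) -> J (g - h) -> J (f - h).
Proof. by move=> H1 H2; rewrite -[f](subrK g) -addrA; apply: giD. Qed.

Lemma giDD f1 f2 g1 g2 : J (f1 - g1) -> J (f2 - g2) -> J (f1 + f2 - (g1 + g2)).
Proof. by move=> H1 H2; rewrite opprD addrACA; apply: giD. Qed.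

Lemma giZZ c f g : J (f - g) -> J (c *: f - c *: g).
Proof. by move=> H; rewrite -scalerBr; apply: giZ. Qed.

Lemma giMM f1 f2 g1 g2 : J (f1 - g1) -> J (f2 - g2) -> J (f1 * f2 - g1 * g2).
Proof.
move=> H1 H2; apply: (@gi_trans _ (g1 * f2)).
  by rewrite -mulrBl; apply: giMr.
by rewrite -mulrBr; apply: giMl.
Qed.

Lemma gi_coefB c c' f : inId R (c - c') -> J (c *: f - c' *: f).
Proof. by move=> H; rewrite -scalerBl; apply: gi_coef. Qed.

Lemma lieDl f1 f2 g : lie (f1 + f2) g = lie f1 g + lie f2 g.
Proof. by rewrite /lie mulrDl mulrDr opprD addrACA. Qed.

Lemma lieDr f g1 g2 : lie f (g1 + g2) = lie f g1 + lie f g2.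
Proof. by rewrite /lie mulrDl mulrDr opprD addrACA. Qed.

Lemma lieZl c f g : lie (c *: f) g = c *: lie f g.
Proof. by rewrite /lie -scalerAl kYX_scaleMr -scalerBr. Qed.

Lemma lieZr c f g : lie f (c *: g) = c *: lie f g.
Proof. by rewrite /lie -scalerAl kYX_scaleMr -scalerBr. Qed.

Lemma lie_jacobi f g h :
  lie (lie f g) h + lie (lie g h) f + lie (lie h f) g = 0.
Proof. exact: commutator_jacobi. Qed.

(** The quotient of [A<X>] by [J] satisfies every axiom and relation of [U_K], so equality there
    becomes ideal membership. *)
Lemma AEq_sound a1 a2 : AEq R S a1 a2 -> J (aeval a1 - aeval a2).
Proof.
elim=> {a1 a2} /=.
- by move=> a; apply: giE.
- by move=> a1 a2 _; apply: giC.
- by move=> a1 a2 a3 _ H1 _; apply: gi_trans H1.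
- by move=> a1 a2 b1 b2 _ H1 _ H2; apply: giDD.
- by move=> c a b _; apply: giZZ.
- by move=> a1 a2 b1 b2 _ H1 _ H2; apply: giMM.
- by move=> a1 a2 a3; apply/giE/addrA.
- by move=> a1 a2; apply/giE/addrC.
- by move=> a; apply/giE/add0r.
- by move=> a; apply: giE; rewrite scaleN1r subrr.
- by move=> c d a; apply/giE/scalerDl.
- by move=> c a b; apply/giE/scalerDr.
- by move=> c d a; apply: giE; rewrite scalerA.
- by move=> a; apply/giE/scale1r.
- by move=> c d a; apply: gi_coefB.
- by move=> a1 a2 a3; apply/giE/mulrA.
- by move=> a; apply/giE/mul1r.
- by move=> a; apply/giE/mulr1.
- by move=> a1 a2 a3; apply/giE/mulrDl.
- by move=> a1 a2 a3; apply/giE/mulrDr.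
- by move=> c a b; apply: giE; rewrite -scalerAl.
- by move=> c a b; apply/giE/kYX_scaleMr.
- by move=> e Se; rewrite aeval_ltoa subr0; apply: gi_rel.
Qed.

Lemma LEq_sound e1 e2 : LEq R S e1 e2 -> J (leval e1 - leval e2).
Proof.
elim=> {e1 e2} /=.
- by move=> a; apply: giE.
- by move=> a1 a2 _; apply: giC.
- by move=> a1 a2 a3 _ H1 _; apply: gi_trans H1.
- by move=> a1 a2 b1 b2 _ H1 _ H2; apply: giDD.
- by move=> c a b _; apply: giZZ.
- move=> a1 a2 b1 b2 _ H1 _ H2; rewrite /lie opprD addrACA -opprD.
  by apply: giB; [exact: giMM|exact: giMM].
- by move=> a1 a2 a3; apply/giE/addrA.
- by move=> a1 a2; apply/giE/addrC.
- by move=> a; apply/giE/add0r.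
- by move=> a; apply: giE; rewrite scaleN1r subrr.
- by move=> c d a; apply/giE/scalerDl.
- by move=> c a b; apply/giE/scalerDr.
- by move=> c d a; apply: giE; rewrite scalerA.
- by move=> a; apply/giE/scale1r.
- by move=> c d a; apply: gi_coefB.
- by move=> a1 a2 a3; apply/giE/lieDl.
- by move=> a1 a2 a3; apply/giE/lieDr.
- by move=> c a b; apply/giE/lieZl.
- by move=> c a b; apply/giE/lieZr.
- by move=> a; apply: giE; rewrite /lie subrr.
- by move=> a1 a2 a3; apply/giE/lie_jacobi.
- by move=> e Se; rewrite subr0; apply: gi_rel.
Qed.

End Relations.

(** Empty relations: [LEq0] is equality in the Lie algebra over [k[Y]] presented by generators [X]
    alone. *)
Definition none (T : Type) : T -> Prop := fun _ => False.
Local Notation LEq0 := (LEq (@none A) (@none M)).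

(** Without relations the ideal [J] is zero. *)
Lemma LEq0_leval e1 e2 : LEq0 e1 e2 -> leval e1 = leval e2.
Proof.
move/LEq_sound=> H; apply/eqP; rewrite -subr_eq0; apply/eqP.
elim: H => [s []|c f [l [Hl ->]]||f g _ -> _ ->|f g _ ->|f g _ ->] //.
- case: l Hl => [|p l] Hl; first by rewrite big_nil scale0r.
  by case: (Hl p); left.
- by rewrite addr0.
- by rewrite mulr0.
- by rewrite mul0r.
Qed.

Lemma LEq0_sub (R : A -> Prop) (S : M -> Prop) e1 e2 : LEq0 e1 e2 -> LEq R S e1 e2.
Proof.
elim=> {e1 e2}.
- exact: LEq_refl.
- by move=> e1 e2 _; exact: LEq_sym.
- by move=> e1 e2 e3 _ H1 _; exact: LEq_trans H1.
- by move=> e1 e2 e3 e4 _ H1 _; exact: LEq_add H1.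
- by move=> c e e' _; exact: LEq_scale.
- by move=> e1 e2 e3 e4 _ H1 _; exact: LEq_br H1.
- exact: LEq_addA.
- exact: LEq_addC.
- exact: LEq_add0.
- exact: LEq_addN.
- exact: LEq_scaleDl.
- exact: LEq_scaleDr.
- exact: LEq_scaleA.
- exact: LEq_scale1.
- by move=> c d e [l [Hl E]]; apply: LEq_coefId; exists l; split=> // p /Hl.
- exact: LEq_brDl.
- exact: LEq_brDr.
- exact: LEq_brZl.
- exact: LEq_brZr.
- exact: LEq_alt.
- exact: LEq_jacobi.
- by [].
Qed.

Lemma inLie_lexp s : inLie s -> exists e, leval e = s.
Proof.
elim=> {s} [x||f g _ [e1 <-] _ [e2 <-]|c f _ [e <-]|f g _ [e1 <-] _ [e2 <-]].
- by exists (LGen x).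
- by exists LZero.
- by exists (LAdd e1 e2).
- by exists (LScale c e).
- by exists (LBr e1 e2).
Qed.

Local Notation LSp0 := (LSp (@none A) (@none M)).

Lemma LSp0_low P e : LSp0 P e -> low wrd (fun v => exists2 w, P w & dlge w v) (leval e).
Proof.
elim=> {e} [w Hw Pw||e1 e2 _ H1 _ H2|c e _ H|e1 e2 /LEq0_leval -> //] /=.
- rewrite leval_lstd; apply: low_sub (low_of_lead (lead_bracket Hw)) => v wv.
  by exists w.
- exact: low0.
- exact: lowD.
- exact: lowZ.
Qed.

Lemma LSp0_lt W e : LSp0 (dlgt W) e -> low wrd (dlgt W) (leval e).
Proof.
move/LSp0_low; apply: low_sub => v [w]; exact: dlgt_ge_trans.
Qed.

(** * Reduction of Lie elements lying in the associative ideal *)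

Section Embedding.
Hypotheses (wfX : well_ordered X).
Variables (R : A -> Prop) (S : M -> Prop).
Hypotheses (SL : forall s, S s -> inLie s) (SG : GSB S)
  (SM : forall s, S s -> kYmonic s).
Local Notation J := (gen_ideal S (inId R)).
Local Notation FA := kYX_free.

Lemma LSp0_coef V c e' : alsw V -> LSp0 (dlgt V) e' ->
  wcoef V (leval (LAdd (LScale c (lstd V)) e')) = c.
Proof.
move=> HV He; rewrite /= leval_lstd (cfD FA) (cfZ FA) (lead_cf FA (lead_bracket HV)).
by rewrite (low_coef0 FA (LSp0_lt He)) ?mulr1 ?addr0 // dlgt_irr.
Qed.

Lemma LSp0_coef_gt V U c e' : alsw V -> LSp0 (dlgt V) e' -> dlgt U V ->
  wcoef U (leval (LAdd (LScale c (lstd V)) e')) = 0.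
Proof.
move=> HV He UV; rewrite /= leval_lstd (cfD FA) (cfZ FA).
rewrite (low_coef0 FA (low_of_lead (lead_bracket HV))) ?mulr0 ?add0r; last first.
  by move=> VU; have := dlgt_ge_trans UV VU; rewrite dlgt_irr.
apply: (low_coef0 FA (LSp0_lt He)) => VU.
by have := dlgt_trans UV VU; rewrite dlgt_irr.
Qed.

(** Turns a bound on the evaluation into one on the formal expression. By triangularity, the
    coefficient of a top bracket [[V]] is the coefficient of the word [V], which is zero while
    [V >= W], so the bound descends. *)
Lemma low_LSp0 W e : low wrd (dlgt W) (leval e) -> LSp0 (dlgt W) e.
Proof.
have wf := dlgt_wf wfX.
have maxP P : LSp0 P e -> (forall V, P V -> LSp0 (dlge V) e -> LSp0 (dlgt W) e) ->
    LSp0 (dlgt W) e.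
  case/LSp_max=> [E _|[V PV H] HV]; last exact: HV PV H.
  exact: LSp_eq E (LSp_0 _ _ _).
move=> lowW; apply: (maxP _ (LSp_all _ _ wfX e)) => V _.
elim: (wf V) => {}V _ IH HV.
case: (dlgt_total W V) => [WV|VW].
  by apply: LSp_sub HV => w _; apply: dlgt_ge_trans.
have done_lt : LSp0 (dlgt V) e -> LSp0 (dlgt W) e by move=> H; apply: (maxP _ H) => U VU; exact: IH.
case: (LSp_top HV) => [//|[Vl [c [e' [He' E]]]]].
apply: done_lt; apply: (LSp_eq E); have := LSp0_coef c Vl He'.
rewrite -(LEq0_leval E) (low_coef0 FA lowW) => [c0|WV].
  by apply: LSpD He'; rewrite -c0; apply: LSp_eq (LEq_scale0r _ _ _) (LSp_0 _ _ _).
by have := dlge_gt_trans VW WV; rewrite dlgt_irr.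
Qed.

(** An expression of [s] fills the hole of the special bracketing; it is a relator, and brackets
    with zero vanish. *)
Lemma nsw_lexp s a b : S s -> alsw (a ++ lwX s ++ b) ->
  exists2 e, leval e = nsw s a b & LEq R S e LZero.
Proof.
move=> Ss H; case: (inLie_lexp (SL Ss)) => e Ee.
exists (tlex e (spec_tree true a (lwX s) b)); first by rewrite leval_tlex Ee.
apply: (tlex_hol (hol_spec (alswS SM Ss) H)).
by apply: LEq_rel; rewrite Ee.
Qed.

Lemma nsw_lead s a b : S s -> alsw (a ++ lwX s ++ b) ->
  lead wrd (nsw s a b) (a ++ lwX s ++ b).
Proof.
move=> Ss H; rewrite /lead.
have L := leadM FA (leadM FA (lead_wrd wrd a) (leadS SM Ss)) (lead_wrd wrd b).
rewrite -catA in L; rewrite -[nsw _ _ _](subrK (wrd a * s * wrd b)) -addrA.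
apply: lowD L; apply: low_sub (asp_low FA (leadS SM) (nsw_asp SM Ss H)) => v [w].
exact: dlgt_ge_trans.
Qed.

Lemma ideal_LEq0 e : J (leval e) -> LEq R S e LZero.
Proof.
have wf := dlgt_wf wfX.
suff key V : forall e, LSp0 (dlge V) e -> J (leval e) -> LEq R S e LZero.
  case: (LSp_max (LSp_all (@none A) (@none M) wfX e)) => [H _|[V _]].
    exact: LEq0_sub.
  exact: key.
elim: (wf V) => {e}V _ IH e HV HJ.
have low_case e' : LSp0 (dlgt V) e' -> J (leval e') -> LEq R S e' LZero.
  case/LSp_max=> [H _|[U VU]]; first exact: LEq0_sub.
  exact: IH.
case: (LSp_top HV) => [/low_case|[Vl [c [e' [He' E]]]]]; first exact.
have ER := LEq0_sub R S E; rewrite (LEq0_leval E) in HJ.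
(* For [c] in [Id(R)] the top term is zero in [Lie_K(X|S)] and lies in [J], so [e'] replaces [e]. *)
case: (Classical_Prop.classic (inId R c)) => Ic.
  have Ec : LEq R S e e'.
    apply: LEq_trans ER _; apply: LEq_trans _ (LEq_add0 R S e').
    apply: LEq_add; last exact: LEq_refl.
    by apply: LEq_trans _ (LEq_scale0r R S (lstd V)); apply: LEq_coefId; rewrite subr0.
  apply: LEq_trans Ec _; apply: low_case => //.
  rewrite -[leval e'](addKr (leval (LScale c (lstd V)))); apply: giD => //.
  by apply: giN; apply: gi_coef.
(* The coefficient at [V] is [c], outside [Id(R)], and all coefficients above vanish, so [V]
   contains a leading word of [S]. *)
have HI : Ilead wcoef (inId R) (leval (LAdd (LScale c (lstd V)) e')) V.
  split=> [|U UV]; first by rewrite LSp0_coef.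
  by rewrite LSp0_coef_gt //; apply: inId0.
have [a [s [b [Ss EV]]]] := gen_ideal_reducible FA (leadS SM) (incl_asp SG SM)
  (overlap_asp SG SM) (@inId0 R) (@inIdD R) (@inIdM R) wf HJ HI.
rewrite EV in Vl; have [n En Ln] := nsw_lexp Ss Vl.
(* [d] equals [[V]] in [Lie_K(X|S)], yet its leading terms cancel: bracket and normal s-word both
   have leading word [V] with coefficient 1. *)
pose d := LAdd (lstd V) (LScale (-1) n).
have Ed : LEq R S d (lstd V).
  apply: LEq_trans _ (LEq_addr0 R S _); apply: LEq_add; first exact: LEq_refl.
  apply: LEq_trans _ (LEq_scaler0 R S (-1)); exact: LEq_scale.
have ld : leval d = bracket V - nsw s a b by rewrite /= scaleN1r leval_lstd En.
have Hd : LSp0 (dlgt V) d.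
  apply: low_LSp0; rewrite ld.
  have -> : bracket V - nsw s a b = (bracket V - wrd V) - (nsw s a b - wrd V).
    by rewrite opprB addrA subrK.
  rewrite EV; apply: lowB; [exact: lead_bracket|exact: nsw_lead].
apply: LEq_trans ER _.
(* Replacing [[V]] by [d] subtracts [c] times a normal s-word, which lies in [J], and brings the
   expression below [V]. *)
apply: LEq_trans (LEq_add (LEq_scale c (LEq_sym Ed)) (LEq_refl R S e')) _.
apply: low_case; first by apply: LSpD He'; apply: LSpZ.
have -> : leval (LAdd (LScale c d) e') =
    leval (LAdd (LScale c (lstd V)) e') - c *: nsw s a b.
  by rewrite /= -/d -/(leval d) scaleN1r En scalerBr addrAC.
apply: giB => //; apply: giZ; rewrite -En -[leval n]subr0.
exact: LEq_sound Ln.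
Qed.

Lemma ltoa_embedding : embeds_in_UEA R S.
Proof.
move=> e1 e2 /AEq_sound; rewrite !aeval_ltoa => H.
have /ideal_LEq0 : J (leval (LAdd e1 (LScale (-1) e2))) by rewrite /= scaleN1r.
move/LEq_cancel => E; apply: LEq_trans E _.
apply: LEq_trans (LEq_sym (LEq_scaleA _ _ _ _ _)) _.
rewrite mulrNN mulr1; exact: LEq_scale1.
Qed.

End Embedding.
End Soundness.

Theorem theorem4p5 (k : fieldType) (dX dY : Order.disp_t)
    (X : orderType dX) (Y : orderType dY)
    (wfX : well_ordered X) (wfY : well_ordered Y)
    (R : @kY k _ Y -> Prop) (S : @kYX k _ _ X Y -> Prop) :
  (forall s, S s -> inLie s) ->
  GSB S ->
  (forall s, S s -> kYmonic s) ->
  embeds_in_UEA R S.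
Proof. exact: ltoa_embedding. Qed.
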